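(* There exist constants $c>0,c_1>0$ depending only on $d$ and $a$ (in particular independent of $k$, $m$, $L$, $\bar\mu_0\ge0$ and the size of $\Omega$) such that for all $x\in\Omega$ and $y\in\Omega_k$, $$|(G_k(\Omega)Q^*_{\Omega,k})(x,y)|\le c\,e^{-c_1|x-y|}.$$
   Context: Setup: $d\ge1$, odd integer $L>1$, integers $k\ge1$, $m\ge k$, $\eta=L^{-k}$, $\Omega=\eta\{0,\dots,L^m-1\}^d$, $\Omega_k=\{0,\dots,L^{m-k}-1\}^d$. $\mathcal L^2(\Omega)$ has inner product $\eta^d\sum_{x\in\Omega}\bar fg$ and $\mathcal L^2(\Omega_k)$ has $\sum_{y\in\Omega_k}\bar fg$. For $y\in\mathbb Z^d$, $B_k(y)=\{x\in\eta\mathbb Z^d: y_\mu\le x_\mu<y_\mu+1\ \forall\mu\}$; $(Q_{\Omega,k}f)(y)=L^{-kd}\sum_{x\in B_k(y)}f(x)$ for $y\in\Omega_k$, with adjoint $(Q^*_{\Omega,k}h)(x)=h(y_x)$, $x\in B_k(y_x)$. Neumann Laplacian $(\Delta^\eta_\Omega f)(x)=\eta^{-2}\sum_\mu(f(x+\eta e_\mu)-2f(x)+f(x-\eta e_\mu))$ with $f(x\pm\eta e_\mu):=f(x)$ if $x\pm\eta e_\mu\notin\Omega$. Fix $a\in(0,1]$, $a_k=a\frac{1-L^{-2}}{1-L^{-2k}}$, $\bar\mu_0\ge0$, $\bar\mu_k=L^{2k}\bar\mu_0$, $G_k(\Omega)=(-\Delta^\eta_\Omega+\bar\mu_k+a_kQ^*_{\Omega,k}Q_{\Omega,k})^{-1}$.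 The kernel is $(G_k(\Omega)Q^*_{\Omega,k})(x,y)=(G_k(\Omega)Q^*_{\Omega,k}\mathbb 1_{\{y\}})(x)$ with $\mathbb 1_{\{y\}}$ the indicator of $y$ on $\Omega_k$. *)

(* Defs.v *)
From HB Require Import structures.
From mathcomp Require Import all_boot all_order all_algebra.
From mathcomp Require Import reals sequences exp.
Set Implicit Arguments. Unset Strict Implicit. Unset Printing Implicit Defensive.
Import Order.TTheory GRing.Theory Num.Theory.
Local Open Scope ring_scope.

Section BlockSpin.
Variables (R : realType) (d L k m : nat).

(* Omega = eta * {0,..,L^m-1}^d : a point is stored by its lattice index i,
   the physical point being eta * i.  Omega_k = {0,..,L^(m-k)-1}^d. *)
Local Notation Om := {ffun 'I_d -> 'I_(L ^ m)}.
Local Notation Ok := {ffun 'I_d -> 'I_(L ^ (m - k))}.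

Definition eta : R := ((L%:R) ^+ k)^-1.

Definition inBlock (y : Ok) (x : Om) : bool :=
  [forall mu : 'I_d, ((y mu)%:R <= eta * (x mu)%:R) && (eta * (x mu)%:R < (y mu)%:R + 1)].

(* x + s*eta*e_mu with the Neumann convention: if the neighbour lies outside
   Omega, it is replaced by x itself (insubd returns x mu when n >= L^m). *)
Definition nbr (x : Om) (mu : 'I_d) (n : nat) : Om :=
  [ffun nu => if nu == mu then insubd (x mu) n else x nu].

Definition lapN (f : Om -> R) (x : Om) : R :=
  eta ^- 2 * \sum_(mu : 'I_d)
     (f (nbr x mu (x mu).+1) - 2 * f x + f (nbr x mu (x mu).-1)).

Definition Qop (f : Om -> R) (y : Ok) : R :=
  ((L%:R) ^+ (k * d))^-1 * \sum_(x : Om | inBlock y x) f x.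

(* Q^*_{Omega,k} h (x) = h(y_x), x \in B_k(y_x) (y_x is the unique such y) *)
Definition Qadj (h : Ok -> R) (x : Om) : R :=
  \sum_(y : Ok | inBlock y x) h y.

Definition a_k (a : R) : R := a * (1 - (L%:R) ^- 2) / (1 - (L%:R) ^- (2 * k)).
Definition mu_k (mu0 : R) : R := (L%:R) ^+ (2 * k) * mu0.

Definition opA (a mu0 : R) (f : Om -> R) (x : Om) : R :=
  - lapN f x + mu_k mu0 * f x + a_k a * Qadj (Qop f) x.

Definition matA (a mu0 : R) : 'M[R]_#|{: Om}| :=
  \matrix_(i, j) opA a mu0 (fun x => (x == enum_val j)%:R) (enum_val i).

Definition GQ_kernel (a mu0 : R) (x : Om) (y : Ok) : R :=
  (invmx (matA a mu0) *m
     \col_j Qadj (fun y' : Ok => (y' == y)%:R) (enum_val j)) (enum_rank x) 0.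

Definition dist (x : Om) (y : Ok) : R :=
  Num.sqrt (\sum_(mu : 'I_d) (eta * (x mu)%:R - (y mu)%:R) ^+ 2).

End BlockSpin.

(* Main.v *)
Require Import Defs.
From HB Require Import structures.
From mathcomp Require Import all_boot all_order all_algebra.
From mathcomp Require Import boolp.
From mathcomp Require Import reals sequences exp.
From mathcomp Require Import ring lra zify.
Set Implicit Arguments. Unset Strict Implicit. Unset Printing Implicit Defensive.
Import Order.TTheory GRing.Theory Num.Theory.
Local Open Scope ring_scope.

(** Write A = 1 + mu_k - Lap and u = G Q^* 1_y, so that A u = f + u with
    f = Q^* 1_y - a_k Q^* Q u.  A Poincare inequality on unit blocks makes the
    operator coercive uniformly in eta, and conjugating it by exp (c rho(., y))
    (Combes-Thomas) bounds u in an exponentially weighted l^2 norm; hence f decays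
    exponentially pointwise.  Pointwise decay of u itself follows from
      u(x) = sum_(1 <= j <= d) <A^-j delta_x, f> + <A^-d delta_x, u>.
    The kernels A^-j delta_x are nonnegative by the minimum principle, have
    exponential moments because a product of hyperbolic cosines centred at x is a
    supersolution of A (also at the Neumann boundary, where it increases outwards),
    and A^-d delta_x is bounded uniformly in eta: the one-dimensional Sobolev
    inequality, iterated over the directions, controls sup |v|^2 by mixed
    derivatives of order at most d, and these are controlled by <v, A^d v>. *)
(** * Kernels acting on one coordinate *)

Section Along.
Variables (R : realFieldType) (d N : nat).
Local Notation Om := {ffun 'I_d -> 'I_N}.
Implicit Types (x z : Om) (mu nu : 'I_d) (k : 'I_N -> 'I_N -> R) (f g : Om -> R).

Definition upd x mu (t : 'I_N) : Om :=
  [ffun nu => if nu == mu then t else x nu].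

Definition dot f g : R := \sum_x f x * g x.

(** In tensor-product terms this is [k] acting in the factor [mu] and the identity in the others.
    Differences, their transposes and block averages all have this form, so commutation and
    adjointness are proved once for all of them. *)
Definition along mu k f x : R := \sum_t k (x mu) t * f (upd x mu t).

Lemma upd_eq x mu t : upd x mu t mu = t.
Proof. by rewrite ffunE eqxx. Qed.

Lemma upd_neq x mu nu t : nu != mu -> upd x mu t nu = x nu.
Proof. by move=> /negPf h; rewrite ffunE h. Qed.

Lemma upd_id x mu : upd x mu (x mu) = x.
Proof. by apply/ffunP => nu; rewrite ffunE; case: eqP => [->|]. Qed.

Lemma upd_upd x mu s t : upd (upd x mu s) mu t = upd x mu t.
Proof. by apply/ffunP => nu; rewrite !ffunE; case: eqP. Qed.

Lemma updC x mu nu s t : mu != nu ->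
  upd (upd x mu s) nu t = upd (upd x nu t) mu s.
Proof.
move=> h; apply/ffunP => i; rewrite !ffunE.
by case: (eqVneq i mu) => // ->; rewrite (negPf h).
Qed.

(** Exchanging [t] with the coordinate [x mu] is an involution of the pairs [(x, t)]; the double sum
    is reindexed by it. *)
Lemma sum_upd_swap mu (F : Om -> Om -> R) :
  \sum_x \sum_t F x (upd x mu t) = \sum_x \sum_t F (upd x mu t) x.
Proof.
rewrite !pair_bigA /=.
have inv : involutive (fun p : Om * 'I_N => (upd p.1 mu p.2, p.1 mu)).
  by case=> x t /=; rewrite upd_upd upd_id upd_eq.
rewrite (reindex_inj (inv_inj inv)) /=.
by apply: eq_bigr => -[x t] _ /=; rewrite upd_upd upd_id.
Qed.

Lemma sum_upd mu f : \sum_x \sum_t f (upd x mu t) = N%:R * \sum_x f x.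
Proof.
rewrite (sum_upd_swap mu (fun _ => f)) mulr_sumr.
by apply: eq_bigr => x _; rewrite sumr_const card_ord mulr_natl.
Qed.

Lemma dotC f g : dot f g = dot g f.
Proof. by apply: eq_bigr => x _; rewrite mulrC. Qed.

Lemma dotDl f1 f2 g : dot (fun x => f1 x + f2 x) g = dot f1 g + dot f2 g.
Proof. by rewrite -big_split; apply: eq_bigr => x _; rewrite mulrDl. Qed.

Lemma dotDr f1 f2 g : dot g (fun x => f1 x + f2 x) = dot g f1 + dot g f2.
Proof. by rewrite dotC dotDl !(dotC g). Qed.

Lemma dotZl a f g : dot (fun x => a * f x) g = a * dot f g.
Proof. by rewrite mulr_sumr; apply: eq_bigr => x _; rewrite mulrA. Qed.

Lemma dotZr a f g : dot f (fun x => a * g x) = a * dot f g.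
Proof. by rewrite dotC dotZl dotC. Qed.

Lemma dot_sumr (I : finType) g (F : I -> Om -> R) :
  dot g (fun x => \sum_i F i x) = \sum_i dot g (F i).
Proof. by rewrite exchange_big; apply: eq_bigr => x _; rewrite mulr_sumr. Qed.

Lemma dot_ge0 f : 0 <= dot f f.
Proof. by apply: sumr_ge0 => x _; rewrite -expr2 sqr_ge0. Qed.

Lemma dot_eq0 f : dot f f <= 0 -> f =1 (fun=> 0).
Proof.
move=> h x; have := h; rewrite /dot (bigD1 x) //= => h0.
have h1 : 0 <= \sum_(i | i != x) f i * f i.
  by apply: sumr_ge0 => z _; rewrite -expr2 sqr_ge0.
apply/eqP; rewrite -sqrf_eq0 eq_le sqr_ge0 andbT expr2; lra.
Qed.

Lemma dot_delta x g : dot (fun z => (z == x)%:R) g = g x.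
Proof.
rewrite /dot (bigD1 x) //= eqxx mul1r big1 ?addr0 // => z /negPf ->.
by rewrite mul0r.
Qed.

Lemma alongD mu k f g :
  along mu k (fun x => f x + g x) = (fun x => along mu k f x + along mu k g x).
Proof.
by apply/funext => x; rewrite -big_split; apply: eq_bigr => t _; rewrite mulrDr.
Qed.

Lemma alongZ mu k c f :
  along mu k (fun x => c * f x) = (fun x => c * along mu k f x).
Proof.
by apply/funext => x; rewrite mulr_sumr; apply: eq_bigr => t _; rewrite mulrCA.
Qed.

Lemma along_sum mu k (I : finType) (F : I -> Om -> R) :
  along mu k (fun x => \sum_i F i x) = (fun x => \sum_i along mu k (F i) x).
Proof.
apply/funext => x; rewrite exchange_big; apply: eq_bigr => t _.
by rewrite mulr_sumr.
Qed.

Lemma alongC mu nu k k' f : mu != nu ->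
  along mu k (along nu k' f) = along nu k' (along mu k f).
Proof.
move=> h; apply/funext => x; rewrite /along.
under eq_bigr => t _ do rewrite mulr_sumr.
under [RHS]eq_bigr => t _ do rewrite mulr_sumr.
rewrite exchange_big; apply: eq_bigr => t _; apply: eq_bigr => s _.
by rewrite mulrCA updC // !upd_neq // eq_sym.
Qed.

Lemma along_comp mu k k' f :
  along mu k (along mu k' f) =
  along mu (fun s t => \sum_r k s r * k' r t) f.
Proof.
apply/funext => x; rewrite /along.
under eq_bigr => t _ do rewrite mulr_sumr.
under [RHS]eq_bigr => t _ do rewrite mulr_suml.
rewrite exchange_big; apply: eq_bigr => t _; apply: eq_bigr => s _.
by rewrite upd_upd upd_eq mulrA.
Qed.

Lemma along_adj mu k f g :
  dot g (along mu k f) = dot (along mu (fun s t => k t s) g) f.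
Proof.
rewrite /dot /along.
under eq_bigr => x _ do rewrite mulr_sumr.
under [RHS]eq_bigr => x _ do rewrite mulr_suml.
pose F := fun x z : Om => g x * (k (x mu) (z mu) * f z).
transitivity (\sum_x \sum_t F x (upd x mu t)).
  by apply: eq_bigr => x _; apply: eq_bigr => t _; rewrite /F upd_eq.
rewrite sum_upd_swap; apply: eq_bigr => x _; apply: eq_bigr => t _.
by rewrite /F upd_eq mulrCA mulrA.
Qed.

Definition alongs (s : seq 'I_d) k f := foldr (fun mu => along mu k) f s.

Lemma alongs_commute s mu k k' f : mu \notin s ->
  along mu k (alongs s k' f) = alongs s k' (along mu k f).
Proof.
elim: s => //= nu s IH; rewrite inE negb_or => /andP[h1 h2].
by rewrite alongC // IH.
Qed.

Lemma alongsD s k f g :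
  alongs s k (fun x => f x + g x) = (fun x => alongs s k f x + alongs s k g x).
Proof. by elim: s => //= mu s ->; rewrite alongD. Qed.

Lemma alongsZ s k c f :
  alongs s k (fun x => c * f x) = (fun x => c * alongs s k f x).
Proof. by elim: s => //= mu s ->; rewrite alongZ. Qed.

Lemma alongs_kernel s k f x : uniq s ->
  alongs s k f x =
  \sum_(z : Om) (\prod_mu (if mu \in s then k (x mu) (z mu) else (x mu == z mu)%:R))
         * f z.
Proof.
elim: s x => [|mu s IH] x /=.
  rewrite (bigD1 x) //= big1 ?mul1r ?big1 ?addr0 // => [z zx|i _].
    have [i hi] : exists i, x i != z i.
      by apply/existsP; move: zx; apply: contraNT => /existsPn h;
        apply/eqP/ffunP => i; apply/eqP; rewrite eq_sym; apply: negbNE.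
    by rewrite (bigD1 i) //= (negPf hi) !mul0r.
  by rewrite eqxx.
move=> /andP[mus us].
transitivity (\sum_t \sum_(z : Om) k (x mu) t * ((\prod_nu (if nu \in s
    then k (upd x mu t nu) (z nu) else (upd x mu t nu == z nu)%:R)) * f z)).
  by apply: eq_bigr => t _; rewrite -mulr_sumr -IH.
rewrite exchange_big; apply: eq_bigr => z _ /=.
(* The direction [mu] is outside [s], so its Kronecker factor leaves only [t = z mu] in the sum. *)
rewrite (bigD1 (z mu)) //= [X in _ + X]big1 ?addr0 => [|t tz]; last first.
  by rewrite (bigD1 mu) //= (negPf mus) upd_eq (negPf tz) !mul0r mulr0.
rewrite mulrA; congr (_ * _).
rewrite (bigD1 mu) //= [in RHS](bigD1 mu) //= inE eqxx (negPf mus) upd_eq eqxx mul1r.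
congr (_ * _); apply: eq_bigr => nu h.
by rewrite inE (negPf h) /= upd_neq.
Qed.

Lemma alongs_enum k f x :
  alongs (enum 'I_d) k f x = \sum_(z : Om) (\prod_mu k (x mu) (z mu)) * f z.
Proof.
rewrite alongs_kernel ?enum_uniq //; apply: eq_bigr => z _; congr (_ * _).
by apply: eq_bigr => mu _; rewrite mem_enum.
Qed.

End Along.

(** The right side minus the left side is half the double sum of [w i * w j * (g i - g j) ^+ 2]. *)
Lemma weighted_cauchy_schwarz (R : realFieldType) (I : finType) (w g : I -> R) :
  (forall i, 0 <= w i) ->
  (\sum_i w i * g i) ^+ 2 <= (\sum_i w i) * \sum_i w i * g i ^+ 2.
Proof.
move=> w0.
have : 0 <= \sum_i \sum_j w i * w j * (g i - g j) ^+ 2.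
  by apply: sumr_ge0 => i _; apply: sumr_ge0 => j _; apply: mulr_ge0; [exact: mulr_ge0 | exact: sqr_ge0].
have -> : \sum_i \sum_j w i * w j * (g i - g j) ^+ 2 =
   2 * ((\sum_i w i) * (\sum_i w i * g i ^+ 2) - (\sum_i w i * g i) ^+ 2).
  rewrite expr2 mulrBr [X in 2 * X - _]mulr_suml [X in _ - 2 * X]mulr_suml.
  transitivity (\sum_i (w i * g i ^+ 2 * (\sum_j w j)
       + w i * (\sum_j w j * g j ^+ 2) - 2 * (w i * g i * \sum_j w j * g j))).
    apply: eq_bigr => i _; rewrite !mulr_sumr -big_split -sumrB /=.
    by apply: eq_bigr => j _; ring.
  rewrite !big_split /= -!mulr_suml sumrN -mulr_sumr -!mulr_suml; ring.
lra.
Qed.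

(** * The one-dimensional Neumann difference *)

Section Line.
Variables (R : realFieldType) (N l M : nat).
Hypotheses (NE : N = (M * l)%N) (l0 : (0 < l)%N).
Implicit Types (s t r : 'I_N) (f : 'I_N -> R).

(** When the neighbour falls outside the line, [insubd] returns [t], which is the Neumann
    reflection. At 0 the truncated predecessor has the same effect. *)
Definition up t : 'I_N := insubd t t.+1.
Definition dn t : 'I_N := insubd t t.-1.
Definition same s t := (s %/ l == t %/ l)%N.

Lemma sum_same s : \sum_t (same s t)%:R = l%:R :> R.
Proof.
have sM : (s %/ l < M)%N by rewrite ltn_divLR // -NE.
(* Count block by block: the [l] indices starting at [M' * l] all have quotient [M']. *)
have key M' b : \sum_(0 <= i < M' * l) (b == i %/ l)%N%:R
    = (if (b < M')%N then l%:R else 0) :> R.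
  elim: M' => [|M' IH]; first by rewrite mul0n big_geq.
  rewrite (big_cat_nat (n := (M' * l)%N)) //=; last by rewrite leq_mul2r leqnSn orbT.
  rewrite IH mulSn -{1}[(M' * l)%N]add0n big_addn addnK big_mkord.
  rewrite (eq_bigr (fun=> (b == M')%:R)); last first.
    by move=> i _; rewrite [(i + _)%N]addnC divnMDl // divn_small // addn0.
  rewrite sumr_const card_ord [in RHS]ltnS [in RHS]leq_eqVlt.
  by case: (ltngtP b M') => h /=; rewrite ?mul0rn ?addr0 ?add0r.
have := key M (s %/ l)%N; rewrite sM -NE big_mkord => <-.
exact: eq_bigr.
Qed.

Lemma same_sym s t : same s t = same t s.
Proof. exact: eq_sym. Qed.

Lemma val_up t : (t.+1 < N)%N -> up t = t.+1 :> nat.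
Proof. by move=> h; rewrite /up val_insubd h. Qed.

Lemma up_last t : (t.+1 < N)%N = false -> up t = t.
Proof. by move=> h; apply: ord_inj; rewrite /up /= val_insubd h. Qed.

Lemma val_dn t : dn t = t.-1 :> nat.
Proof.
by rewrite /dn val_insubd (leq_ltn_trans (leq_pred t) (ltn_ord t)).
Qed.

Lemma telescope_up f s n (h : (s + n < N)%N) :
  f (Ordinal h) - f s = \sum_(r : 'I_N | (s <= r < s + n)%N) (f (up r) - f r).
Proof.
elim: n h => [|n IH] h.
  rewrite big1 => [|r]; last by lia.
  have -> : Ordinal h = s by apply: ord_inj; rewrite /= addn0.
  by rewrite subrr.
have h' : (s + n < N)%N by lia.
rewrite (bigD1 (Ordinal h')) /=; last by lia.
rewrite (eq_bigl (fun r : 'I_N => (s <= r < s + n)%N)); last first.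
  by move=> r; rewrite -val_eqE /=; lia.
rewrite -IH.
have -> : up (Ordinal h') = Ordinal h.
  by apply: ord_inj; rewrite val_up /= ?addnS //; lia.
ring.
Qed.

(** Telescope from [s] to [t] and apply Cauchy-Schwarz: the bonds crossed all start in the common
    block, and there are at most [l] of them. *)
Lemma sqr_diff_same f s t : same s t ->
  (f s - f t) ^+ 2 <= l%:R * \sum_r (same s r)%:R * (f (up r) - f r) ^+ 2.
Proof.
wlog st : s t / (s <= t)%N.
  move=> H; case: (leqP s t) => [|/ltnW] h e; first exact: H.
  rewrite -opprB sqrrN; rewrite same_sym in e.
  apply: le_trans (H _ _ h e) _; rewrite ler_wpM2l ?ler0n //.
  by apply: ler_sum => r _; rewrite /same (eqP e).
move=> e; have h : (s + (t - s) < N)%N by rewrite subnKC.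
have -> : t = Ordinal h by apply: ord_inj; rewrite /= subnKC.
rewrite -opprB sqrrN telescope_up subnKC //.
pose w r : R := (s <= r < t)%N%:R.
have ws r : w r <= (same s r)%:R.
  rewrite /w; case: (boolP (s <= r < t)%N) => // /andP[h1 h2].
  rewrite /same; have -> // : (s %/ l == r %/ l)%N.
  have /eqP e' := e; rewrite eqn_leq leq_div2r //= e'.
  by rewrite leq_div2r // ltnW.
rewrite big_mkcond /=.
rewrite (eq_bigr (fun r => w r * (f (up r) - f r))); last first.
  by move=> r _; rewrite /w; case: ifP; rewrite ?mul1r ?mul0r.
apply: le_trans (weighted_cauchy_schwarz _ _) _ => [r|]; first by rewrite ler0n.
apply: ler_pM.
- by apply: sumr_ge0 => r _; rewrite ler0n.
- by apply: sumr_ge0 => r _; rewrite mulr_ge0 ?ler0n ?sqr_ge0.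
- by rewrite -(sum_same s); apply: ler_sum => r _.
- by apply: ler_sum => r _; rewrite ler_wpM2r ?sqr_ge0.
Qed.

(** The lattice spacing is [l%:R^-1], so that a block has unit length. [avgk] is the orthogonal
    projection onto functions constant on blocks. *)
Definition avgk s t : R := l%:R^-1 * (same s t)%:R.
Definition diffk s t : R := l%:R * ((up s == t)%:R - (s == t)%:R).

Let lR0 : (l%:R : R) != 0. Proof. by rewrite pnatr_eq0 -lt0n. Qed.

Lemma avgk_ge0 s t : 0 <= avgk s t.
Proof. by rewrite mulr_ge0 ?invr_ge0 ?ler0n. Qed.

Lemma avgk_sym s t : avgk s t = avgk t s.
Proof. by rewrite /avgk same_sym. Qed.

Lemma sum_avgk s : \sum_t avgk s t = 1.
Proof. by rewrite -mulr_sumr sum_same mulVf. Qed.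

Lemma avgk_idem s t : \sum_r avgk s r * avgk r t = avgk s t.
Proof.
transitivity (\sum_r avgk s r * avgk s t); last by rewrite -mulr_suml sum_avgk mul1r.
apply: eq_bigr => r _; rewrite /avgk /same.
by case: eqP => [->//|_]; rewrite mulr0 !mul0r.
Qed.

Lemma sum_diffk f s : \sum_t diffk s t * f t = l%:R * (f (up s) - f s).
Proof.
under eq_bigr => t _ do rewrite /diffk -mulrA mulrBl.
rewrite -mulr_sumr sumrB (bigD1 (up s)) //= eqxx mul1r.
rewrite [X in _ * (_ - X)](bigD1 s) //= eqxx mul1r !big1 ?addr0 // => i /negPf h;
  by rewrite eq_sym h mul0r.
Qed.

(* [diffk] is the Neumann forward difference, so its transpose composed with it
   is minus the Neumann second difference. *)
Lemma diffk_diffk f t :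
  \sum_s diffk s t * (\sum_r diffk s r * f r) =
  - (l%:R ^+ 2 * (f (up t) - 2 * f t + f (dn t))).
Proof.
(* Only [s = dn t] contributes: any other [s] with [up s = t] is the last site, where [up s = s] and
   the difference vanishes. For [t = 0] both sides are zero. *)
have key : \sum_s (up s == t)%:R * (f (up s) - f s) = f t - f (dn t).
  case: (posnP t) => [t0|t0].
    have -> : dn t = t by apply: ord_inj; rewrite val_dn t0.
    rewrite subrr big1 // => s _; case: eqP => [e|]; last by rewrite mul0r.
    case h : (s.+1 < N)%N.
      by have := val_up h; rewrite e t0.
    by rewrite (up_last h) subrr mulr0.
  have ht : ((dn t).+1 < N)%N by rewrite val_dn prednK.
  have upt : up (dn t) = t by apply: ord_inj; rewrite val_up // val_dn prednK.
  rewrite (bigD1 (dn t)) //= upt eqxx mul1r big1 ?addr0 // => s sd.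
  case: eqP => [e|]; last by rewrite mul0r.
  case h : (s.+1 < N)%N; last by rewrite (up_last h) subrr mulr0.
  case/negP: sd; rewrite -val_eqE /= val_dn.
  by have := val_up h; rewrite e => ->.
under eq_bigr => s _ do rewrite sum_diffk.
transitivity (l%:R ^+ 2 * (\sum_s (up s == t)%:R * (f (up s) - f s)
                         - \sum_s (s == t)%:R * (f (up s) - f s))).
  by rewrite -sumrB mulr_sumr; apply: eq_bigr => s _; rewrite /diffk; ring.
rewrite key (bigD1 t) //= eqxx mul1r big1 ?addr0; first by ring.
by move=> s /negPf ->; rewrite mul0r.
Qed.

(** Twice the defect between [f] and its block average is the [avgk]-weighted sum of the squared
    differences inside blocks, and [sqr_diff_same] bounds each of these by the gradient on its
    block. Unit block length makes the constant independent of [l]. *)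
Lemma line_poincare f :
  \sum_s f s ^+ 2 <= \sum_s f s * (\sum_t avgk s t * f t)
                     + \sum_s (l%:R * (f (up s) - f s)) ^+ 2.
Proof.
set G := \sum_s (l%:R * _) ^+ 2.
have G0 : 0 <= G by apply: sumr_ge0 => s _; rewrite sqr_ge0.
have e : 2 * (\sum_s f s ^+ 2 - \sum_s f s * (\sum_t avgk s t * f t)) =
         \sum_s \sum_t avgk s t * (f s - f t) ^+ 2.
  transitivity (\sum_s \sum_t (avgk s t * f s ^+ 2)
     + \sum_s \sum_t avgk s t * f t ^+ 2
     - 2 * \sum_s f s * \sum_t avgk s t * f t).
    rewrite [X in _ + X - _]exchange_big /=.
    rewrite [X in X + _ - _](eq_bigr (fun s => f s ^+ 2)); last first.
      by move=> s _; rewrite -mulr_suml sum_avgk mul1r.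
    rewrite [X in _ + X - _](eq_bigr (fun s => f s ^+ 2)); last first.
      move=> s _; under eq_bigr => t _ do rewrite avgk_sym.
      by rewrite -mulr_suml sum_avgk mul1r.
    ring.
  rewrite -big_split /= mulr_sumr -sumrB; apply: eq_bigr => s _.
  rewrite -big_split /= !mulr_sumr -sumrB; apply: eq_bigr => t _; ring.
have b : \sum_s \sum_t avgk s t * (f s - f t) ^+ 2 <= G.
  apply: (@le_trans _ _ (\sum_s \sum_t avgk s t *
       (l%:R * \sum_r (same s r)%:R * (f (up r) - f r) ^+ 2))).
    apply: ler_sum => s _; apply: ler_sum => t _.
    case h : (same s t); first by rewrite ler_wpM2l ?avgk_ge0 // sqr_diff_same.
    by rewrite /avgk h mulr0 !mul0r.
  under eq_bigr => s _ do rewrite -mulr_suml sum_avgk mul1r mulr_sumr.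
  rewrite exchange_big /= /G; apply: ler_sum => r _.
  under eq_bigr => s _ do rewrite mulrCA same_sym.
  rewrite -mulr_suml sum_same exprMn expr2 mulrA; lra.
lra.
Qed.

(** Bound [f s ^+ 2] by [2 * f t ^+ 2] plus twice the squared difference, and average over [t] in
    the block of [s]. *)
Lemma line_sobolev f s :
  f s ^+ 2 <= 2 * \sum_t l%:R^-1 * (f t ^+ 2 + (l%:R * (f (up t) - f t)) ^+ 2).
Proof.
set G := fun t => (l%:R * (f (up t) - f t)) ^+ 2.
have G0 t : 0 <= G t by rewrite sqr_ge0.
have li : 0 <= (l%:R^-1 : R) by rewrite invr_ge0 ler0n.
have b t : same s t -> f s ^+ 2 <= 2 * f t ^+ 2 + 2 * \sum_r l%:R^-1 * G r.
  move=> /(sqr_diff_same f) h.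
  have : (f s - f t) ^+ 2 <= \sum_r l%:R^-1 * G r.
    apply: le_trans h _; rewrite mulr_sumr; apply: ler_sum => r _.
    rewrite /G [X in _ <= _ * X]exprMn [l%:R ^+ 2]expr2 !mulrA mulVf // mul1r.
    rewrite -?mulrA ler_wpM2l ?ler0n // ler_piMl ?sqr_ge0 //.
    by case: (same s r); rewrite ?lexx ?ler01.
  have : 0 <= (f s - 2 * f t) ^+ 2 by rewrite sqr_ge0.
  lra.
have -> : f s ^+ 2 = \sum_t avgk s t * f s ^+ 2 by rewrite -mulr_suml sum_avgk mul1r.
apply: (@le_trans _ _ (\sum_t avgk s t * (2 * f t ^+ 2 + 2 * \sum_r l%:R^-1 * G r))).
  apply: ler_sum => t _; case h : (same s t).
    by rewrite ler_wpM2l ?avgk_ge0 // b.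
  by rewrite /avgk h mulr0 !mul0r.
under eq_bigr => t _ do rewrite mulrDr.
have -> : \sum_t l%:R^-1 * (f t ^+ 2 + G t) =
    \sum_t l%:R^-1 * f t ^+ 2 + \sum_t l%:R^-1 * G t.
  by rewrite -big_split; apply: eq_bigr => t _; rewrite mulrDr.
rewrite big_split /= -mulr_suml sum_avgk mul1r mulrDr lerD2r mulr_sumr.
apply: ler_sum => t _; rewrite mulrCA ler_wpM2l // ler_wpM2r ?sqr_ge0 //.
by rewrite /avgk ler_piMr //; case: (same s t); rewrite ?lexx ?ler01.
Qed.

End Line.

(** * Poincare and mixed Sobolev inequalities on the box *)

Section Box.
Variables (R : realFieldType) (d N l M : nat).
Hypotheses (NE : N = (M * l)%N) (l0 : (0 < l)%N) (N0 : (0 < N)%N).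
Local Notation Om := {ffun 'I_d -> 'I_N}.
Implicit Types (x z : Om) (mu nu : 'I_d) (f g v : Om -> R) (s : seq 'I_d).
Local Notation Dk := (@diffk R N l).
Local Notation Pk := (@avgk R N l).
Local Notation avg mu := (along mu Pk).

Definition grad mu : (Om -> R) -> Om -> R := along mu Dk.

Lemma gradE mu f x : grad mu f x = l%:R * (f (upd x mu (up (x mu))) - f x).
Proof. by rewrite /grad /along (sum_diffk l (fun t => f (upd x mu t))) upd_id. Qed.

(** Summing over all points and then over the line through each counts every point [N] times, so
    one-dimensional inequalities pass to the box. *)
Lemma ler_sum_line mu f g :
  (forall x, \sum_t f (upd x mu t) <= \sum_t g (upd x mu t)) ->
  \sum_x f x <= \sum_x g x.
Proof.
move=> h; rewrite -(ler_pM2l (_ : 0 < N%:R :> R)) ?ltr0n // -!(sum_upd mu).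
exact: ler_sum.
Qed.

Lemma avg_idem mu f : avg mu (avg mu f) = avg mu f.
Proof.
rewrite along_comp; congr (along mu _ f).
by apply/funext => s; apply/funext => t; exact: (avgk_idem R NE l0).
Qed.

Lemma avg_adj mu f g : dot g (avg mu f) = dot (avg mu g) f.
Proof.
rewrite along_adj; congr (dot (along mu _ g) f).
by apply/funext => s; apply/funext => t; exact: avgk_sym.
Qed.

Lemma avg_proj mu f : dot f (avg mu f) = dot (avg mu f) (avg mu f).
Proof. by rewrite -avg_adj avg_idem. Qed.

Lemma avg_contract mu f : dot (avg mu f) (avg mu f) <= dot f f.
Proof.
have := dot_ge0 (fun x => f x + (-1) * avg mu f x).
rewrite dotDl !dotDr !dotZl !dotZr -avg_proj (dotC (avg mu f)) => h; lra.
Qed.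

(** The average along [mu] is doubled by idempotence; one copy moves to the left slot by symmetry,
    the other commutes through the remaining directions. *)
Lemma avgs_proj mu s f : mu \notin s ->
  dot f (alongs (mu :: s) Pk f) = dot (avg mu f) (alongs s Pk (avg mu f)).
Proof.
move=> ms; rewrite -alongs_commute // -avg_adj.
by rewrite (_ : along mu Pk (along mu Pk _) = avg mu (alongs s Pk f)) ?avg_idem.
Qed.

Lemma avgs_ge0 s f : uniq s -> 0 <= dot f (alongs s Pk f).
Proof.
elim: s f => [|mu s IH] f; first by rewrite dot_ge0.
by move=> /andP[ms us]; rewrite avgs_proj // IH.
Qed.

Lemma poincare_dir mu f :
  dot f f <= dot f (avg mu f) + dot (grad mu f) (grad mu f).
Proof.
rewrite /dot -big_split /=; apply: (@ler_sum_line mu) => x.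
have := line_poincare NE l0 (fun t => f (upd x mu t)).
rewrite -big_split /= => h; apply: le_trans (le_trans h _).
  by apply: ler_sum => t _; rewrite expr2.
apply: ler_sum => t _; rewrite gradE upd_upd upd_eq expr2.
have -> // : avg mu f (upd x mu t) = \sum_r Pk t r * f (upd x mu r).
by apply: eq_bigr => r _; rewrite upd_eq upd_upd.
Qed.

(* Telescoping over the directions: averaging along [mu] commutes with the
   gradients in the other directions and is an orthogonal projection. *)
Lemma poincare s f : uniq s ->
  dot f f <= dot f (alongs s Pk f) + \sum_(mu <- s) dot (grad mu f) (grad mu f).
Proof.
elim: s f => [|mu s IH] f; first by rewrite big_nil addr0.
move=> /andP[ms us]; rewrite avgs_proj // big_cons.
apply: le_trans (poincare_dir mu f) _.
rewrite addrA [leRHS]addrAC lerD2r avg_proj.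
apply: le_trans (IH _ us) _; rewrite lerD2l !big_seq.
apply: ler_sum => nu nus; rewrite /grad alongC ?avg_contract //.
by apply: contraNneq ms => <-.
Qed.

(** Expanded, this is [2 ^+ size s] times the sum of the squared mixed gradients over all subsets of
    the directions in [s]. *)
Fixpoint sobolev_energy s f x : R :=
  if s is mu :: s' then
    2 * (sobolev_energy s' f x + sobolev_energy s' (grad mu f) x)
  else f x ^+ 2.

Lemma sobolev s f x :
  f x ^+ 2 <= alongs s (fun _ _ => l%:R^-1) (sobolev_energy s f) x.
Proof.
elim: s f x => //= mu s IH f x; rewrite alongsZ alongsD alongZ.
have := line_sobolev NE l0 (fun t => f (upd x mu t)) (x mu).
rewrite upd_id => h; apply: le_trans h _; rewrite ler_wpM2l ?ler0n //.
apply: ler_sum => t _; rewrite ler_wpM2l ?invr_ge0 ?ler0n // lerD //.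
by apply: le_trans (IH _ _); rewrite gradE upd_upd upd_eq.
Qed.

Lemma sup_le_energy f x :
  f x ^+ 2 <= (l%:R^-1) ^+ d * \sum_z sobolev_energy (enum 'I_d) f z.
Proof.
apply: le_trans (sobolev (enum 'I_d) f x) _.
by rewrite alongs_enum prodr_const card_ord mulr_sumr.
Qed.

(* [gradb b mu] is the forward difference with Neumann boundary conditions in
   direction [mu] when [b mu] is false, and its adjoint when [b mu] is true;
   [massive kappa b] is then [kappa] minus the Laplacian with Neumann or Dirichlet
   conditions according to [b]. *)
Implicit Types (b : 'I_d -> bool) (kappa : R).
Definition gradb b mu := along mu (if b mu then (fun i j => Dk j i) else Dk).
Definition gradbT b mu := along mu (if b mu then Dk else (fun i j => Dk j i)).
Definition massive kappa b f x : R :=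
  kappa * f x + \sum_mu gradbT b mu (gradb b mu f) x.
Definition flip b mu : 'I_d -> bool := fun nu => b nu (+) (nu == mu).

Lemma gradb_adj b mu f g : dot g (gradbT b mu f) = dot (gradb b mu g) f.
Proof. by rewrite /gradb /gradbT along_adj; case: (b mu). Qed.

(** A difference operator D satisfies D (D^T D) = (D D^T) D, so moving it past the operator flips
    the boundary condition in its own direction; in the other directions it commutes. *)
Lemma gradb_massive kappa b mu f :
  gradb b mu (massive kappa b f) = massive kappa (flip b mu) (gradb b mu f).
Proof.
rewrite /massive {1}/gradb alongD alongZ along_sum; apply/funext => x.
congr (_ + _); apply: eq_bigr => nu _.
have [->|nm] := eqVneq nu mu.
  by rewrite /gradbT /gradb /flip eqxx; case: (b mu).
rewrite /gradbT /gradb /flip (negPf nm) addbF.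
by rewrite [along mu _ (along nu _ _)]alongC 1?eq_sym // [along mu _ (along nu _ _)]alongC 1?eq_sym.
Qed.

Lemma gradb_iter kappa b mu n f :
  gradb b mu (iter n (massive kappa b) f) =
  iter n (massive kappa (flip b mu)) (gradb b mu f).
Proof. by elim: n => //= n IH; rewrite gradb_massive IH. Qed.

Lemma dot_iter_massiveS kappa b n v :
  dot v (iter n.+1 (massive kappa b) v) =
  kappa * dot v (iter n (massive kappa b) v) +
  \sum_mu dot (gradb b mu v) (iter n (massive kappa (flip b mu)) (gradb b mu v)).
Proof.
rewrite /= {1}/massive dotDr dotZr dot_sumr; congr (_ + _).
by apply: eq_bigr => mu _; rewrite gradb_adj gradb_iter.
Qed.

Lemma dot_iter_massive_ge0 kappa b n v : 0 <= kappa ->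
  0 <= dot v (iter n (massive kappa b) v).
Proof.
move=> k0; elim: n b v => [|n IH] b v; first exact: dot_ge0.
by rewrite dot_iter_massiveS addr_ge0 ?mulr_ge0 // sumr_ge0.
Qed.

(** Each gradient costs one power of the operator. Both terms of the energy are bounded by the form
    with [n.+1] powers, which with the factor 2 of the energy gives 4 per direction. The induction
    runs over all [b] because a gradient flips its direction; directions still in [s] are unflipped,
    so there [gradb] is [grad]. *)
Lemma energy_le_massive kappa b n s v : 1 <= kappa -> uniq s ->
  {in s, forall mu, ~~ b mu} -> (size s <= n)%N ->
  \sum_x sobolev_energy s v x <= 4 ^+ size s * dot v (iter n (massive kappa b) v).
Proof.
move=> k1; have k0 : 0 <= kappa by lra.
have mono b' n' w : dot w (iter n' (massive kappa b') w)
                 <= dot w (iter n'.+1 (massive kappa b') w).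
  have p := dot_iter_massive_ge0 b' n' w k0.
  rewrite dot_iter_massiveS -[leLHS]addr0; apply: lerD; first by rewrite ler_peMl.
  by apply: sumr_ge0 => nu _; exact: dot_iter_massive_ge0.
elim: s b n v => [|mu s IH] b n v /=.
  move=> _ _ _; rewrite expr0 mul1r.
  elim: n => [|n IHn]; last exact: le_trans IHn (mono _ _ _).
  by apply: ler_sum => x _; rewrite expr2.
case: n => // n /andP[ms us] bs sn.
rewrite -mulr_sumr big_split /=.
have bs' nu : nu \in s -> ~~ b nu by move=> h; rewrite bs // inE h orbT.
have h1 := IH b n v us bs' sn.
have h2 : \sum_x sobolev_energy s (grad mu v) x <= 4 ^+ size s *
    dot (gradb b mu v) (iter n (massive kappa (flip b mu)) (gradb b mu v)).
  have bmu := bs mu (mem_head _ _).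
  have <- : grad mu v = gradb b mu v by rewrite /gradb (negPf bmu).
  apply: IH => // nu nus; rewrite /flip.
  rewrite (negPf (bs' nu nus)) /=.
  by apply: contraNneq ms => <-.
have p : 0 <= (4 : R) ^+ size s by rewrite exprn_ge0.
have h3 : dot (gradb b mu v) (iter n (massive kappa (flip b mu)) (gradb b mu v))
     <= dot v (iter n.+1 (massive kappa b) v).
  rewrite dot_iter_massiveS (bigD1 mu) //= addrCA -[leLHS]addr0 lerD2l addr_ge0 //.
    by apply: mulr_ge0 => //; exact: dot_iter_massive_ge0.
  by apply: sumr_ge0 => nu _; exact: dot_iter_massive_ge0.
have h4 := ler_wpM2l p h3.
have h5 := ler_wpM2l p (mono b n v).
rewrite exprS; lra.
Qed.

Lemma massive_laplacian kappa f x :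
  massive kappa (fun=> false) f x = kappa * f x -
    l%:R ^+ 2 * \sum_mu (f (upd x mu (up (x mu))) - 2 * f x + f (upd x mu (dn (x mu)))).
Proof.
rewrite /massive mulr_sumr -sumrN; congr (_ + _); apply: eq_bigr => mu _.
rewrite /gradb /gradbT /= {1}/along.
have := diffk_diffk l (fun t => f (upd x mu t)) (x mu).
rewrite upd_id => <-; apply: eq_bigr => t _; congr (_ * _).
by rewrite /along upd_eq; apply: eq_bigr => r _; rewrite upd_upd.
Qed.

Lemma massive_form kappa f g :
  dot g (massive kappa (fun=> false) f) =
  kappa * dot g f + \sum_mu dot (grad mu g) (grad mu f).
Proof.
rewrite /massive dotDr dotZr dot_sumr; congr (_ + _).
by apply: eq_bigr => mu _; rewrite gradb_adj.
Qed.

(** Here [v] is the kernel of the [d]-th inverse power, so its form equals [l%:R ^+ d * v x] and the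
    volume factor cancels: [v w ^+ 2 <= 4 ^+ d * v x] for every [w]. Taking [w = x] bounds [v x],
    and then the whole of [v]. *)
Lemma green_power_le kappa v x z : 1 <= kappa ->
  iter d (massive kappa (fun=> false)) v = (fun w => l%:R ^+ d * (w == x)%:R) ->
  v z <= 4 ^+ d.
Proof.
move=> k1 hv; have lR : 0 < (l%:R : R) by rewrite ltr0n.
have sup w : v w ^+ 2 <= 4 ^+ d * v x.
  apply: le_trans (sup_le_energy _ _) _.
  rewrite exprVn ler_pdivrMl ?exprn_gt0 //.
  have := energy_le_massive (b := fun=> false) v k1 (enum_uniq 'I_d).
  move=> /(_ d (fun=> fun=> isT)); rewrite size_enum_ord leqnn => /(_ isT).
  by rewrite hv dotZr dotC dot_delta mulrCA.
have c0 : 0 < (4 : R) ^+ d by rewrite exprn_gt0.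
have vx : v x <= 4 ^+ d.
  rewrite leNgt; apply/negP => h; have := sup x.
  by rewrite expr2 ler_pM2r ?(lt_trans c0) // leNgt h.
have : v z ^+ 2 <= (4 ^+ d) ^+ 2.
  by apply: le_trans (sup z) _; rewrite expr2 ler_wpM2l // ltW.
rewrite leNgt => h; rewrite leNgt; apply: contra h => h.
by rewrite ltrXn2r // ltW.
Qed.

End Box.

(** * Solving injective linear systems on a finite function space *)

Section LinearSystem.
Variables (R : fieldType) (X : finType) (T : (X -> R) -> X -> R).
Hypothesis TD : forall f g, T (fun x => f x + g x) = (fun x => T f x + T g x).
Hypothesis TZ : forall c f, T (fun x => c * f x) = (fun x => c * T f x).
Hypothesis T_inj : forall f, T f =1 (fun=> 0) -> f =1 (fun=> 0).

Definition mx_of : 'M[R]_#|X| :=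
  \matrix_(i, j) T (fun x => (x == enum_val j)%:R) (enum_val i).

Lemma mx_ofE (v : 'cV[R]_#|X|) x :
  T (fun y => v (enum_rank y) 0) x = (mx_of *m v) (enum_rank x) 0.
Proof.
have T_sum (I : finType) (F : I -> X -> R) :
    T (fun x => \sum_i F i x) = (fun x => \sum_i T (F i) x).
  have T0 : T (fun=> 0) = (fun=> 0).
    have := TZ 0 (fun=> 0).
    have -> : (fun _ : X => 0 * 0 : R) = fun=> 0 by apply/funext => z; rewrite mulr0.
    by move=> ->; apply/funext => z; rewrite mul0r.
  elim: (index_enum I) => [|i r IH].
    have -> : (fun x => \sum_(i <- [::]) F i x) = fun=> 0.
      by apply/funext => z; rewrite big_nil.
    by rewrite T0; apply/funext => z; rewrite big_nil.
  have -> : (fun x => \sum_(j <- i :: r) F j x) =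
            (fun x => F i x + \sum_(j <- r) F j x).
    by apply/funext => z; rewrite big_cons.
  by rewrite TD IH; apply/funext => z; rewrite big_cons.
have -> : (fun y => v (enum_rank y) 0) =
          (fun y => \sum_j v j 0 * (y == enum_val j)%:R).
  apply/funext => y; rewrite (bigD1 (enum_rank y)) //= enum_rankK eqxx mulr1.
  rewrite big1 ?addr0 // => j h; case: eqP => [e|]; last by rewrite mulr0.
  by rewrite e enum_valK eqxx in h.
rewrite T_sum mxE; apply: eq_bigr => j _.
by rewrite TZ mxE enum_rankK mulrC.
Qed.

Lemma mx_of_unit : mx_of \in unitmx.
Proof.
rewrite -unitmx_tr -row_free_unit; apply: inj_row_free => v hv.
have hv' : mx_of *m v^T = 0 by apply: trmx_inj; rewrite trmx_mul trmxK trmx0.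
have /T_inj h : T (fun y => v^T (enum_rank y) 0) =1 (fun=> 0).
  by move=> x; rewrite mx_ofE hv' mxE.
apply/rowP => j; have := h (enum_val j).
by rewrite enum_valK !mxE.
Qed.

Lemma invmx_solves g :
  T (fun x => (invmx mx_of *m \col_j g (enum_val j)) (enum_rank x) 0) = g.
Proof.
apply/funext => x; rewrite mx_ofE mulmxA mulmxV ?mx_of_unit // mul1mx mxE.
by rewrite enum_rankK.
Qed.

End LinearSystem.

(** * Exponential weights *)

Section ExpWeight.
Variable R : realType.
Implicit Types (s t w u : R).

Lemma expR_le2 s : s <= 2^-1 -> expR s <= 2.
Proof.
move=> s1; have := expR_ge1Dx (- s); have := expR_gt0 s; have := expRN s.
move=> -> p h; have : 2^-1 <= (expR s)^-1 by lra.
by rewrite lef_pV2 // posrE.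
Qed.

(** With [e = t - t'] nonnegative, [expR e - 1 <= e * expR e]; one of the two exponentials produced
    by squaring is then bounded by 2. *)
Lemma expR_sqr_diff s t t' : `|t - t'| <= s -> s <= 2^-1 ->
  (expR t - expR t') ^+ 2 <= 2 * s ^+ 2 * (expR t * expR t').
Proof.
wlog tt' : t t' / t' <= t.
  move=> H h s1; case: (leP t' t) => [|/ltW] tt'; first exact: H.
  by rewrite -opprB sqrrN [expR t * _]mulrC H // distrC.
rewrite ger0_norm ?subr_ge0 // => ts s1.
set e := t - t' in ts; have e0 : 0 <= e by rewrite subr_ge0.
have -> : t = t' + e by rewrite /e; ring.
have h1 := expR_ge1Dx (- e); rewrite expRN in h1.
have ee : expR e <= 2 by apply: expR_le2; lra.
have pe := expR_gt0 e; have p' := expR_gt0 t'.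
rewrite expRD.
have h2 : expR e - 1 <= e * expR e.
  have : (1 - e) * expR e <= (expR e)^-1 * expR e by rewrite ler_wpM2r // ltW.
  rewrite mulVf ?gt_eqF //; lra.
have h3 : 1 <= expR e by have := expR_ge1Dx e; lra.
have h4 : (expR e - 1) ^+ 2 <= (e * expR e) ^+ 2 by rewrite lerXn2r ?nnegrE ?mulr_ge0 //; lra.
have h5 : (e * expR e) ^+ 2 <= 2 * s ^+ 2 * expR e.
  have es : e ^+ 2 <= s ^+ 2 by rewrite lerXn2r ?nnegrE //; lra.
  have h5 : e ^+ 2 * expR e <= s ^+ 2 * 2.
    by apply: ler_pM => //; rewrite ?sqr_ge0 ?ltW.
  have := ler_wpM2r (ltW pe) h5; rewrite exprMn; lra.
have -> : (expR t' * expR e - expR t') ^+ 2 = expR t' ^+ 2 * (expR e - 1) ^+ 2 by ring.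
have -> : 2 * s ^+ 2 * (expR t' * expR e * expR t') =
          expR t' ^+ 2 * (2 * s ^+ 2 * expR e) by ring.
by rewrite ler_wpM2l ?sqr_ge0 //; lra.
Qed.

(* Discrete version of (w^2 u)' u' = ((w u)')^2 - (w' u)^2. *)
Lemma weighted_bond (e w w' u u' : R) : 0 < w -> 0 < w' -> 0 <= e <= 1 ->
  (w' - w) ^+ 2 <= e * (w' * w) ->
  2^-1 * (w' * u' - w * u) ^+ 2 - 3 / 2 * e * (w * u) ^+ 2 <=
  (w' ^+ 2 * u' - w ^+ 2 * u) * (u' - u).
Proof.
move=> w0 w0' /andP[e0 e1] h.
set p := w * u; set q := w' * u'.
pose r := (w' - w) ^+ 2 / (w' * w).
have r0 : 0 <= r by rewrite divr_ge0 ?sqr_ge0 // mulr_ge0 ?ltW.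
have re : r <= e by rewrite ler_pdivrMr // mulr_gt0.
have -> : (w' ^+ 2 * u' - w ^+ 2 * u) * (u' - u) = (q - p) ^+ 2 - r * (p * q).
  by rewrite /r /p /q; field; rewrite !gt_eqF.
set D := (q - p) ^+ 2; set S := p ^+ 2.
have D0 : 0 <= D by rewrite sqr_ge0.
have S0 : 0 <= S by rewrite sqr_ge0.
have pq : p * q <= 3 / 2 * S + 2^-1 * D.
  have : 0 <= (p - (q - p)) ^+ 2 by rewrite sqr_ge0.
  rewrite /S /D; lra.
have h1 : r * (p * q) <= r * (3 / 2 * S + 2^-1 * D) by rewrite ler_wpM2l.
have h2 : r * (3 / 2 * S + 2^-1 * D) <= e * (3 / 2 * S + 2^-1 * D).
  by rewrite ler_wpM2r //; lra.
have h3 : e * D <= D by rewrite ler_piMl.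
lra.
Qed.

End ExpWeight.

(** * Minimum principle, rescaled distance and block averages *)

Section Decay.
Variables (R : realType) (d N l M : nat).
Hypotheses (NE : N = (M * l)%N) (l0 : (0 < l)%N) (N0 : (0 < N)%N).
Local Notation Om := {ffun 'I_d -> 'I_N}.
Implicit Types (x y z : Om) (mu nu : 'I_d) (f g u v : Om -> R).
Local Notation neumann kappa := (@massive R d N l kappa (fun=> false)).

Let lR : 0 < (l%:R : R). Proof. by rewrite ltr0n. Qed.

Lemma massiveD kappa f g :
  neumann kappa (fun x => f x + g x) = (fun x => neumann kappa f x + neumann kappa g x).
Proof.
rewrite /massive; apply/funext => x; rewrite mulrDr addrACA -big_split /=.
congr (_ + _); apply: eq_bigr => mu _.
by rewrite /gradbT /gradb !alongD.
Qed.

Lemma massiveZ kappa c f :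
  neumann kappa (fun x => c * f x) = (fun x => c * neumann kappa f x).
Proof.
rewrite /massive; apply/funext => x; rewrite mulrDr mulrCA; congr (_ + _).
by rewrite mulr_sumr; apply: eq_bigr => mu _; rewrite /gradbT /gradb !alongZ.
Qed.

Lemma massive_adj kappa f g : dot g (neumann kappa f) = dot (neumann kappa g) f.
Proof.
rewrite [RHS]dotC !massive_form dotC; congr (_ + _).
by apply: eq_bigr => mu _; rewrite dotC.
Qed.

(** At a minimum point every Neumann second difference is nonnegative, so the hypothesis there
    forces [kappa * f z] to be nonnegative. *)
Lemma minimum_principle kappa f : 0 < kappa ->
  (forall x, 0 <= neumann kappa f x) -> forall x, 0 <= f x.
Proof.
move=> k0 h x.
have [z hz] : exists z, forall x, f z <= f x.
  by case: (Order.TotalTheory.arg_minP (P := xpredT) f (i0 := x)) => // z _ hz; exists z => w; exact: hz.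
apply: le_trans (hz x); have := h z; rewrite massive_laplacian.
have : 0 <= l%:R ^+ 2 * \sum_mu (f (upd z mu (up (z mu))) - 2 * f z + f (upd z mu (dn (z mu)))).
  rewrite mulr_ge0 ?sqr_ge0 // sumr_ge0 // => mu _.
  have := hz (upd z mu (up (z mu))); have := hz (upd z mu (dn (z mu))); lra.
move=> h1 h2; have : 0 <= kappa * f z by lra.
by rewrite pmulr_rge0.
Qed.

(** Injectivity is the minimum principle applied to a null function and to its negative. *)
Lemma green_exists kappa g : 0 < kappa -> exists v, neumann kappa v = g.
Proof.
move=> k0; eexists; apply: invmx_solves; [exact: massiveD | exact: massiveZ |].
move=> f hf x; apply/eqP; rewrite eq_le.
rewrite (minimum_principle k0 (f := f)) ?andbT; last by move=> z; rewrite hf.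
rewrite -oppr_ge0 -mulN1r.
by apply: (minimum_principle k0 (f := fun x => -1 * f x)) => z; rewrite massiveZ hf mulr0.
Qed.

(** The l^1 distance in physical units. Being a sum over directions, it has an exponential that
    factorizes, which suits the product weights below. *)
Definition rho x y : R := \sum_mu l%:R^-1 * `|(x mu)%:R - (y mu)%:R|.

Lemma rho_sym x y : rho x y = rho y x.
Proof. by apply: eq_bigr => mu _; rewrite distrC. Qed.

Lemma rho_triangle x y z : rho x z <= rho x y + rho y z.
Proof.
rewrite -big_split; apply: ler_sum => mu _ /=; rewrite -mulrDr.
by rewrite ler_wpM2l ?invr_ge0 ?ler0n // ler_distD.
Qed.

Lemma rho_dist x y z : `|rho x z - rho y z| <= rho x y.
Proof.
rewrite ler_norml; have := rho_triangle x y z; have := rho_triangle y x z.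
rewrite (rho_sym y x) => h1 h2; lra.
Qed.

Lemma rho_ge0 x y : 0 <= rho x y.
Proof. by apply: sumr_ge0 => mu _; rewrite mulr_ge0 ?invr_ge0. Qed.

Lemma rho_up x mu : rho (upd x mu (up (x mu))) x <= l%:R^-1.
Proof.
rewrite /rho (bigD1 mu) //= big1 ?addr0 => [|nu h]; last first.
  by rewrite upd_neq // subrr normr0 mulr0.
rewrite upd_eq ler_piMr ?invr_ge0 //.
case h : ((x mu).+1 < N)%N; last by rewrite up_last // subrr normr0.
by rewrite val_up // -natr1 addrAC subrr add0r normr1.
Qed.

Definition sameb x y := [forall mu, same l (x mu) (y mu)].

Lemma rho_same x y : sameb x y -> rho x y <= d%:R.
Proof.
move=> /forallP h; rewrite -[d in leRHS]card_ord -sumr_const.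
apply: ler_sum => mu _; rewrite ler_pdivrMl // mulr1 ler_norml.
have /eqP e := h mu.
have := divn_eq (x mu) l; have := divn_eq (y mu) l.
have := ltn_pmod (x mu) l0; have := ltn_pmod (y mu) l0.
rewrite e => h1 h2 h3 h4.
have h5 : (x mu <= y mu + l)%N by clear -h1 h2 h3 h4; lia.
have h6 : (y mu <= x mu + l)%N by clear -h1 h2 h3 h4; lia.
move: h5 h6; rewrite -!(ler_nat R) !natrD => h5 h6; lra.
Qed.

(** This is the operator Q^* Q of the model; see [Qadj_Qop]. *)
Definition bavg : (Om -> R) -> Om -> R := alongs (enum 'I_d) (@avgk R N l).

Definition bker x z : R := \prod_mu avgk R l (x mu) (z mu).

Lemma bavgE f x : bavg f x = \sum_z bker x z * f z.
Proof. by rewrite /bavg alongs_enum. Qed.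

Lemma bkerE x z : bker x z = (l%:R^-1) ^+ d * (sameb x z)%:R.
Proof.
rewrite /bker big_split /= prodr_const card_ord; congr (_ * _).
rewrite -natr_prod; congr _%:R.
rewrite /sameb; case: (boolP [forall _, _]) => [/forallP h|/forallPn[mu h]].
  by rewrite big1 // => mu _; rewrite h.
by rewrite (bigD1 mu) //= (negPf h) mul0n.
Qed.

Lemma bker_sym x z : bker x z = bker z x.
Proof. by apply: eq_bigr => mu _; rewrite avgk_sym. Qed.

Lemma bker_ge0 x z : 0 <= bker x z.
Proof. by rewrite bkerE mulr_ge0 ?exprn_ge0 ?invr_ge0. Qed.

Lemma sum_bker x : \sum_z bker x z = 1.
Proof.
transitivity (bavg (fun=> 1) x); first by rewrite bavgE; under [RHS]eq_bigr do rewrite mulr1.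
rewrite /bavg; elim: (enum 'I_d) x => //= mu s IH x.
rewrite /along; under eq_bigr => t _ do rewrite IH mulr1.
exact: (sum_avgk R NE l0).
Qed.

End Decay.

(** * The Combes-Thomas estimate *)

Section CombesThomas.
Variables (R : realType) (d N l M : nat).
Hypotheses (NE : N = (M * l)%N) (l0 : (0 < l)%N) (N0 : (0 < N)%N).
Local Notation Om := {ffun 'I_d -> 'I_N}.
Implicit Types (x y z : Om) (mu nu : 'I_d) (f g u v : Om -> R).
Local Notation neumann kappa := (@massive R d N l kappa (fun=> false)).
Local Notation rho := (@rho R d N l).
Local Notation bavg := (@bavg R d N l).
Local Notation bker := (@bker R d N l).

Let lR : 0 < (l%:R : R). Proof. by rewrite ltr0n. Qed.

Variable c : R.
Hypotheses (c0 : 0 < c) (cd : c * d%:R <= 5^-1).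
Variable y0 : Om.
Local Notation W := (fun x => expR (c * rho x y0)).

Lemma c_small mu : c <= 5^-1.
Proof.
have d0 : (0 < d)%N by apply: leq_trans (ltn_ord mu).
by apply: le_trans cd; rewrite ler_peMr ?ler1n // ltW.
Qed.

Lemma grad_weighted mu u :
  2^-1 * dot (grad l mu (fun x => W x * u x)) (grad l mu (fun x => W x * u x))
   - 3 * c ^+ 2 * dot (fun x => W x * u x) (fun x => W x * u x)
  <= dot (grad l mu (fun x => W x ^+ 2 * u x)) (grad l mu u).
Proof.
rewrite /dot !mulr_sumr -sumrB; apply: ler_sum => x _.
rewrite !gradE.
set x' := upd x mu _.
(* Along a bond [rho] changes by at most [l%:R^-1], so [expR_sqr_diff] gives this [e]; multiplied by
   [l%:R ^+ 2], the loss [3 / 2 * e] becomes [3 * c ^+ 2], uniformly in [l]. *)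
pose e : R := 2 * (c * l%:R^-1) ^+ 2.
have li : 0 < (l%:R^-1 : R) by rewrite invr_gt0.
have li1 : (l%:R^-1 : R) <= 1 by rewrite invf_le1 // ler1n.
have cl0 : 0 <= c * l%:R^-1 by rewrite mulr_ge0 ?ltW.
have cl : c * l%:R^-1 <= 5^-1.
  apply: le_trans (c_small mu); rewrite ler_piMr // ltW //.
have e0 : 0 <= e <= 1.
  rewrite /e mulr_ge0 ?sqr_ge0 //=.
  have : (c * l%:R^-1) ^+ 2 <= 5^-1 ^+ 2 by rewrite lerXn2r ?nnegrE ?invr_ge0 ?ler0n.
  lra.
have bd : (W x' - W x) ^+ 2 <= e * (W x' * W x).
  apply: expR_sqr_diff; last by apply: le_trans cl _; lra.
  rewrite -mulrBr normrM gtr0_norm // ler_pM2l //.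
  by apply: le_trans (rho_dist _ _ _ _ _) (rho_up _ _ _ _).
have := weighted_bond (u x) (u x') (expR_gt0 _) (expR_gt0 _) e0 bd.
move=> /(ler_wpM2l (sqr_ge0 l%:R)).
rewrite -/(W x) -/(W x') => h.
have l2 : l%:R ^+ 2 * (3 / 2 * e * (W x * u x) ^+ 2) = 3 * c ^+ 2 * (W x * u x * (W x * u x)).
  by rewrite /e; field; rewrite gt_eqF.
move: h l2; rewrite mulrBr => h l2; rewrite l2 in h; lra.
Qed.

(** Symmetrizing in the two points of a block replaces [W x ^+ 2] by the mean of [W x ^+ 2] and
    [W z ^+ 2], which exceeds [W x * W z] by half of [(W x - W z) ^+ 2]. This excess is small since
    [rho] varies by at most [d] in a block. *)
Lemma bavg_weighted u :
  dot (fun x => W x * u x) (bavg (fun x => W x * u x))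
   - (c * d%:R) ^+ 2 * dot (fun x => W x * u x) (fun x => W x * u x)
  <= dot (fun x => W x ^+ 2 * u x) (bavg u).
Proof.
set U := fun x => W x * u x.
have cd0 : 0 <= c * d%:R by rewrite mulr_ge0 // ltW.
have rowsum f : \sum_x \sum_z bker x z * f x = \sum_x f x.
  by apply: eq_bigr => x _; rewrite -mulr_suml (sum_bker R NE l0) mul1r.
have colsum f : \sum_x \sum_z bker x z * f z = \sum_x f x.
  rewrite exchange_big /= -[RHS]rowsum; apply: eq_bigr => x _.
  by apply: eq_bigr => z _; rewrite bker_sym.
have dE f g : dot f (bavg g) = \sum_x \sum_z bker x z * (f x * g z).
  by apply: eq_bigr => x _; rewrite bavgE mulr_sumr; apply: eq_bigr => z _; ring.
have dE' f g : dot f (bavg g) = \sum_x \sum_z bker x z * (f z * g x).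
  rewrite dE exchange_big; apply: eq_bigr => x _; apply: eq_bigr => z _ /=.
  by rewrite bker_sym.
rewrite -(ler_pM2l (_ : 0 < 2 :> R)) // mulrBr.
have -> : 2 * dot U (bavg U) = \sum_x \sum_z bker x z * (2 * (U x * U z)).
  by rewrite dE mulr_sumr; apply: eq_bigr => x _; rewrite mulr_sumr; apply: eq_bigr => z _; ring.
have -> : 2 * dot (fun x => W x ^+ 2 * u x) (bavg u) =
   \sum_x \sum_z bker x z * ((W x ^+ 2 + W z ^+ 2) * (u x * u z)).
  rewrite mulr2n mulrDl mul1r {1}dE dE' -big_split; apply: eq_bigr => x _.
  by rewrite -big_split /=; apply: eq_bigr => z _; ring.
have -> : 2 * ((c * d%:R) ^+ 2 * dot U U) =
   \sum_x \sum_z bker x z * ((c * d%:R) ^+ 2 * (U x ^+ 2 + U z ^+ 2)).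
  transitivity (\sum_x \sum_z bker x z * ((c * d%:R) ^+ 2 * U x ^+ 2)
     + \sum_x \sum_z bker x z * ((c * d%:R) ^+ 2 * U z ^+ 2)).
    rewrite rowsum (colsum (fun x => (c * d%:R) ^+ 2 * U x ^+ 2)) /dot.
    rewrite !mulr_sumr -big_split /=; apply: eq_bigr => x _; ring.
  rewrite -big_split; apply: eq_bigr => x _; rewrite -big_split /=.
  by apply: eq_bigr => z _; ring.
rewrite -sumrB; apply: ler_sum => x _; rewrite -sumrB; apply: ler_sum => z _.
rewrite -mulrBr bkerE; case: (boolP (sameb l x z)) => [xz|_]; last by rewrite mulr0 !mul0r.
rewrite mulr1 ler_wpM2l ?exprn_ge0 ?invr_ge0 ?ler0n //.
have bd : (W x - W z) ^+ 2 <= 2 * (c * d%:R) ^+ 2 * (W x * W z).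
  apply: expR_sqr_diff; last by apply: le_trans cd _; lra.
  rewrite -mulrBr normrM gtr0_norm // ler_pM2l //.
  by apply: le_trans (rho_dist _ _ _ _ _) (rho_same _ l0 xz).
have wx : 0 < W x by rewrite expR_gt0.
have wz : 0 < W z by rewrite expR_gt0.
move: bd wx wz; rewrite /U; move: (W x) (W z) => wx wz bd wx0 wz0.
set k := (c * d%:R) ^+ 2 in bd *.
have k0 : 0 <= k by rewrite sqr_ge0.
have uu : `|u x * u z| * (wx - wz) ^+ 2 <= k * ((wx * u x) ^+ 2 + (wz * u z) ^+ 2).
  apply: le_trans (ler_wpM2l (normr_ge0 _) bd) _.
  have -> : `|u x * u z| * (2 * k * (wx * wz)) = k * (2 * (`|wx * u x| * `|wz * u z|)).
    by rewrite !normrM (gtr0_norm wx0) (gtr0_norm wz0); ring.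
  rewrite ler_wpM2l // -[(wx * u x) ^+ 2]real_normK ?num_real //.
  rewrite -[(wz * u z) ^+ 2]real_normK ?num_real //.
  have := sqr_ge0 (`|wx * u x| - `|wz * u z|); lra.
have := ler_norm (- (u x * u z)); rewrite normrN => h.
have := ler_wpM2r (sqr_ge0 (wx - wz)) h; lra.
Qed.

(** Poincare for [W u] supplies [a / 2]. The conjugation loses at most [3 / 25 * a] in the gradients
    and [a / 25] in the average, which leaves more than [a / 4]. *)
Lemma weighted_coercive (a ak kappa : R) u :
  0 < a -> a <= 1 -> a / 2 <= ak -> ak <= a -> 0 <= kappa -> c * d%:R <= a / 5 ->
  a / 4 * dot (fun x => W x * u x) (fun x => W x * u x) <=
  dot (fun x => W x ^+ 2 * u x) (fun x => neumann kappa u x + ak * bavg u x).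
Proof.
move=> a0 a1 aka ak1 kappa0 ca.
rewrite dotDr massive_form dotZr.
have -> : dot (fun x => W x ^+ 2 * u x) u = dot (fun x => W x * u x) (fun x => W x * u x).
  by apply: eq_bigr => x _; ring.
have hb := bavg_weighted u.
set U := fun x => W x * u x in hb *.
have UU := dot_ge0 U; set S := dot U U in hb UU *.
have hg : \sum_mu (2^-1 * dot (grad l mu U) (grad l mu U) - 3 * c ^+ 2 * S) <=
   \sum_mu dot (grad l mu (fun x => W x ^+ 2 * u x)) (grad l mu u).
  by apply: ler_sum => mu _; exact: grad_weighted.
rewrite sumrB -mulr_sumr sumr_const card_ord -[_ *+ d]mulr_natr in hg.
have hp := poincare NE l0 N0 U (enum_uniq 'I_d).
rewrite big_enum /= in hp.
rewrite -/(bavg U) -/S in hp.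
have p0 : 0 <= dot U (bavg U) by apply: (avgs_ge0 NE l0); exact: enum_uniq.
set G := \sum_mu dot (grad l mu U) (grad l mu U) in hp hg.
have G0 : 0 <= G by apply: sumr_ge0 => mu _; exact: dot_ge0.
have h1 : 3 * c ^+ 2 * S * d%:R <= 3 / 25 * a * S.
  rewrite mulrAC ler_wpM2r // -!mulrA ler_wpM2l //.
  have [d0|d0] := posnP d.
    by rewrite d0 mulr0n !mulr0 mulr_ge0 ?invr_ge0 ?ler0n // ltW.
  have cs := c_small (Ordinal d0).
  have : c * (c * d%:R) <= 5^-1 * (a / 5) by apply: ler_pM; rewrite ?mulr_ge0 // ltW.
  lra.
have h2 : (c * d%:R) ^+ 2 <= 25^-1.
  have : (c * d%:R) ^+ 2 <= 5^-1 ^+ 2 by rewrite lerXn2r ?nnegrE ?invr_ge0 // mulr_ge0 // ltW.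
  lra.
have h3 := ler_wpM2r UU h2.
have ak0 : 0 <= ak by lra.
have h4 : ak * (dot U (bavg U) - (c * d%:R) ^+ 2 * S) <= ak * dot (fun x => W x ^+ 2 * u x) (bavg u).
  by rewrite ler_wpM2l.
have h5 : ak * ((c * d%:R) ^+ 2 * S) <= a * (25^-1 * S).
  by apply: ler_pM => //; rewrite mulr_ge0 ?sqr_ge0.
have h6 : a / 2 * dot U (bavg U) <= ak * dot U (bavg U) by rewrite ler_wpM2r.
have h7 : a / 2 * G <= 2^-1 * G by rewrite ler_wpM2r //; lra.
have a20 : 0 <= a / 2 by lra.
have h8 : a / 2 * S <= a / 2 * (dot U (bavg U) + G) by rewrite ler_wpM2l.
have h9 : 0 <= kappa * S by rewrite mulr_ge0.
have h10 : 0 <= a * S by rewrite mulr_ge0 // ltW.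
lra.
Qed.

End CombesThomas.

(** * Hyperbolic cosine supersolutions *)

Section CoshWeight.
Variables (R : realType) (d N l : nat).
Hypotheses (l0 : (0 < l)%N).
Local Notation Om := {ffun 'I_d -> 'I_N}.
Implicit Types (x y z : Om) (mu nu : 'I_d).

(** Twice the hyperbolic cosine: it dominates the exponential of the absolute value and is smooth
    enough at 0 for second differences. *)
Definition cosh2 (s : R) : R := expR s + expR (- s).

Definition coshw (c : R) x z : R :=
  \prod_mu cosh2 (c * l%:R^-1 * ((z mu)%:R - (x mu)%:R)).

Lemma cosh2_gt0 s : 0 < cosh2 s.
Proof. by rewrite addr_gt0 ?expR_gt0. Qed.

Lemma coshw_gt0 c x z : 0 < coshw c x z.
Proof. by apply: prodr_gt0 => mu _; exact: cosh2_gt0. Qed.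

Lemma coshw_center c x : coshw c x x = 2 ^+ d.
Proof.
rewrite /coshw (eq_bigr (fun=> 2)) ?prodr_const ?card_ord // => mu _.
by rewrite subrr mulr0 /cosh2 oppr0 expR0.
Qed.

Lemma exp_rho_le_coshw c x z : 0 <= c -> expR (c * rho R l z x) <= coshw c x z.
Proof.
move=> c0; rewrite /rho mulr_sumr expR_sum; apply: ler_prod => mu _.
rewrite expR_ge0 /= mulrA.
have cl : 0 <= c * l%:R^-1 by rewrite mulr_ge0 ?invr_ge0.
rewrite -{1}(ger0_norm cl) -normrM /cosh2.
set t := _ * (_ - _); have := expR_gt0 t; have := expR_gt0 (- t).
by case: (ger0P t) => _ p q; lra.
Qed.

(** The gain [expR t * (expR s - 1)] outweighs the loss [expR (- t) * (1 - expR (- s))], because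
    [expR t >= 1 >= expR (- t)] and [expR s + expR (- s) >= 2]. *)
Lemma cosh2_le (s t : R) : 0 <= s -> 0 <= t -> cosh2 t <= cosh2 (t + s).
Proof.
move=> s0 t0; rewrite /cosh2 opprD !expRD.
have h1 : 1 <= expR s by have := expR_ge1Dx s; lra.
have h2 : expR (- s) <= 1 by rewrite -expR0 ler_expR; lra.
have h3 : 1 <= expR t by have := expR_ge1Dx t; lra.
have h4 : expR (- t) <= 1 by rewrite -expR0 ler_expR; lra.
have p3 := expR_gt0 t; have p4 := expR_gt0 (- t).
have e : expR s * expR (- s) = 1 by rewrite -expRD subrr expR0.
have q : 0 <= expR s - 1 by lra.
have q2 : 0 <= 1 - expR (- s) by lra.
have h5 : expR (- t) * (1 - expR (- s)) <= 1 - expR (- s) by rewrite ler_piMl.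
have h6 : expR s - 1 <= expR t * (expR s - 1) by rewrite ler_peMl.
have h7 : 2 <= expR s + expR (- s).
  have := sqr_ge0 (expR s - 1).
  have p5 := expR_gt0 (- s).
  move=> /(mulr_ge0 (ltW p5)); rewrite expr2.
  have -> : expR (- s) * ((expR s - 1) * (expR s - 1)) =
    (expR s * expR (- s)) * (expR s - 2) + expR (- s) by ring.
  rewrite e; lra.
lra.
Qed.

Lemma cosh2N s : cosh2 (- s) = cosh2 s.
Proof. by rewrite /cosh2 opprK addrC. Qed.

(** In the interior this is the addition formula. At an end of the line the reflected neighbour is
    [t] itself, and since the centre [x] lies on the inner side, [cosh2_le] shows that a true outer
    neighbour would only give a larger value. *)
Lemma cosh2_line (s : R) (x t : 'I_N) : 0 <= s -> s <= 2^-1 ->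
  cosh2 (s * ((up t)%:R - x%:R)) + cosh2 (s * ((dn t)%:R - x%:R))
   - 2 * cosh2 (s * (t%:R - x%:R)) <= 2 * s ^+ 2 * cosh2 (s * (t%:R - x%:R)).
Proof.
move=> s0 s1.
have hup : cosh2 (s * ((up t)%:R - x%:R)) <= cosh2 (s * (t%:R - x%:R) + s).
  case h : (t.+1 < N)%N.
    by rewrite val_up // -natr1 (_ : _ - _ = t%:R - x%:R + 1) ?mulrDr ?mulr1 //; ring.
  rewrite up_last // cosh2_le // mulr_ge0 // subr_ge0 ler_nat.
  by have := ltn_ord t; have := ltn_ord x; lia.
have hdn : cosh2 (s * ((dn t)%:R - x%:R)) <= cosh2 (s * (t%:R - x%:R) - s).
  rewrite val_dn; case: (posnP t) => [->|tp].
    rewrite -cosh2N -[leRHS]cosh2N.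
    have -> : - (s * (0.-1%:R - x%:R)) = s * x%:R :> R by rewrite /=; ring.
    have -> : - (s * (0%:R - x%:R) - s) = s * x%:R + s :> R by ring.
    by rewrite cosh2_le // mulr_ge0.
  have -> : (t.-1)%:R = t%:R - 1 :> R by rewrite -{2}(prednK tp) -natr1 addrK.
  by rewrite (_ : _ - 1 - _ = t%:R - x%:R - 1) ?mulrBr ?mulr1 //; ring.
set r := s * (t%:R - x%:R) in hup hdn *.
have e : cosh2 (r + s) + cosh2 (r - s) = cosh2 s * cosh2 r.
  by rewrite /cosh2 !opprD opprK !expRD; ring.
(* [cosh2 s - 2] equals [(expR s - 1) ^+ 2 * expR (- s)]. *)
have h2 : cosh2 s - 2 <= 2 * s ^+ 2.
  have := @expR_sqr_diff R s s 0; rewrite subr0 ger0_norm // expR0 mulr1 => /(_ (lexx _) s1).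
  have ps := expR_gt0 s => h.
  have e1 : expR (- s) * expR s = 1 by rewrite -expRD addNr expR0.
  rewrite -(ler_pM2r ps) /cosh2; lra.
have := ler_wpM2r (ltW (cosh2_gt0 r)) h2; lra.
Qed.

(** The [d] directions together cost at most [2 * c ^+ 2 * d%:R <= 2^-1] times the weight, half of
    what the mass term [kappa >= 1] provides. *)
Lemma massive_coshw c kappa x z : 0 <= c -> c <= 2^-1 -> c ^+ 2 * d%:R <= 4^-1 ->
  1 <= kappa ->
  2^-1 * coshw c x z <= massive l kappa (fun=> false) (coshw c x) z.
Proof.
move=> c0 c1 c2 k1; rewrite massive_laplacian.
have lR : 0 < (l%:R : R) by rewrite ltr0n.
have li1 : (l%:R^-1 : R) <= 1 by rewrite invf_le1 // ler1n.
have li : 0 <= (l%:R^-1 : R) by rewrite invr_ge0 ltW.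
set V := coshw c x; have V0 : 0 < V z by exact: coshw_gt0.
pose s := c * l%:R^-1.
have s0 : 0 <= s by rewrite mulr_ge0.
have s1 : s <= 2^-1 by apply: le_trans c1; rewrite ler_piMr.
have hmu mu : V (upd z mu (up (z mu))) - 2 * V z + V (upd z mu (dn (z mu))) <=
    2 * s ^+ 2 * V z.
  have VE t : V (upd z mu t) = cosh2 (s * (t%:R - (x mu)%:R)) *
      \prod_(nu | nu != mu) cosh2 (s * ((z nu)%:R - (x nu)%:R)).
    rewrite /V /coshw (bigD1 mu) //= upd_eq; congr (_ * _).
    by apply: eq_bigr => nu h; rewrite upd_neq.
  have Vz : V z = V (upd z mu (z mu)) by rewrite upd_id.
  rewrite Vz !VE; set P := \prod_(_ | _) _.
  have P0 : 0 <= P by apply: prodr_ge0 => nu _; exact: ltW (cosh2_gt0 _).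
  have := ler_wpM2r P0 (cosh2_line (x mu) (z mu) s0 s1); lra.
have hs : \sum_mu (V (upd z mu (up (z mu))) - 2 * V z + V (upd z mu (dn (z mu)))) <=
   2 * s ^+ 2 * V z * d%:R.
  rewrite mulr_natr -[d in leRHS]card_ord -sumr_const; exact: ler_sum.
have := ler_wpM2l (sqr_ge0 l%:R) hs.
have -> : l%:R ^+ 2 * (2 * s ^+ 2 * V z * d%:R) = 2 * (c ^+ 2 * d%:R) * V z.
  by rewrite /s; field; rewrite gt_eqF.
have := ler_wpM2r (ltW V0) c2; have := ler_wpM2r (ltW V0) k1; lra.
Qed.

End CoshWeight.

(** * Pointwise decay *)

Section KernelDecay.
Variables (R : realType) (d N l M : nat).
Hypotheses (NE : N = (M * l)%N) (l0 : (0 < l)%N) (N0 : (0 < N)%N).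
Local Notation Om := {ffun 'I_d -> 'I_N}.
Implicit Types (x y z : Om) (mu nu : 'I_d) (f g u v : Om -> R).
Local Notation neumann kappa := (@massive R d N l kappa (fun=> false)).
Local Notation rho := (@rho R d N l).
Local Notation bavg := (@bavg R d N l).
Local Notation bker := (@bker R d N l).
Local Notation h := ((l%:R^-1 : R) ^+ d).

Let lR : 0 < (l%:R : R). Proof. by rewrite ltr0n. Qed.
Let h0 : 0 < h. Proof. by rewrite exprn_gt0 // invr_gt0. Qed.

Lemma sum_sameb y : h * \sum_x (sameb l y x)%:R = 1.
Proof.
transitivity (\sum_x bker y x); last exact: (sum_bker R NE l0).
by rewrite mulr_sumr; apply: eq_bigr => x _; rewrite bkerE.
Qed.

Lemma bilinear_exp_bound (t p q : R) : `|p * q| <= 2^-1 * (p ^+ 2 * expR t + q ^+ 2 * expR (- t)).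
Proof.
have e : expR t * expR (- t) = 1 by rewrite -expRD subrr expR0.
have p1 := expR_gt0 t; have p2 := expR_gt0 (- t).
have := sqr_ge0 (`|p| * expR t - `|q|); move/(mulr_ge0 (ltW p2)).
have -> : expR (- t) * (`|p| * expR t - `|q|) ^+ 2 =
  (expR t * expR (- t)) * (`|p| ^+ 2 * expR t - 2 * (`|p| * `|q|)) + `|q| ^+ 2 * expR (- t) by ring.
rewrite e !real_normK ?num_real // normrM; lra.
Qed.

Variables (a c ak kappa : R) (y0 : Om) (u : Om -> R).
Local Notation W := (fun x => expR (c * rho x y0)).
Local Notation energy := (h * dot (fun x => W x * u x) (fun x => W x * u x)).

(** Coercivity is tested against the source. Young's inequality absorbs half of [a / 4], and
    [W <= 2] on the source block makes the remainder [8 / a]; dividing by [a / 8] gives the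
    constant. *)
Lemma weighted_l2_bound :
  0 < a -> a <= 1 -> a / 2 <= ak -> ak <= a -> 0 <= kappa ->
  0 < c -> c * d%:R <= a / 5 ->
  (forall x, neumann kappa u x + ak * bavg u x = (sameb l y0 x)%:R) ->
  energy <= 64 / a ^+ 2.
Proof.
move=> a0 a1 aka ak1 kappa0 c0 ca hu.
have cd : c * d%:R <= 5^-1 by lra.
have := weighted_coercive NE l0 N0 c0 cd y0 u a0 a1 aka ak1 kappa0 ca.
have -> : (fun x => neumann kappa u x + ak * bavg u x) = (fun x => (sameb l y0 x)%:R).
  by apply/funext.
set U := fun x => W x * u x; move=> hc.
have hb : dot (fun x => W x ^+ 2 * u x) (fun x => (sameb l y0 x)%:R) <=
   a / 8 * dot U U + 8 / a * \sum_x (sameb l y0 x)%:R.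
  rewrite /dot !mulr_sumr -big_split /=; apply: ler_sum => x _.
  have UU : 0 <= a / 8 * (U x * U x).
    by rewrite mulr_ge0 -?expr2 ?sqr_ge0 //; lra.
  case: (boolP (sameb l y0 x)) => [s|_]; last by rewrite !mulr0 addr0.
  have w2 : W x <= 2.
    apply: expR_le2; rewrite rho_sym.
    have := rho_same R l0 s; rewrite -(ler_pM2l c0) => ?; lra.
  have w0 : 0 < W x by exact: expR_gt0.
  have -> : W x ^+ 2 * u x * 1 = W x * U x by rewrite /U; ring.
  have w4 : W x ^+ 2 <= 4.
    have : W x ^+ 2 <= 2 ^+ 2 by rewrite lerXn2r ?nnegrE // ltW.
    lra.
  have ai : 0 < a^-1 by rewrite invr_gt0.
  have h1 : a^-1 * W x ^+ 2 <= a^-1 * 4 by rewrite ler_pM2l.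
  have := sqr_ge0 (4 * W x - a * U x) => /(mulr_ge0 (ltW ai)).
  have -> : a^-1 * (4 * W x - a * U x) ^+ 2 =
    16 * (a^-1 * W x ^+ 2) - 8 * (W x * U x) + a * (U x * U x).
    by field; rewrite gt_eqF.
  have -> : 8 / a * 1 = 8 * a^-1 :> R by rewrite mulr1.
  lra.
have key : a / 8 * dot U U <= 8 / a * \sum_x (sameb l y0 x)%:R by lra.
have := ler_wpM2l (ltW h0) key.
rewrite !(mulrCA h) sum_sameb mulr1 => key'.
have -> : 64 / a ^+ 2 = 8 / a * (8 / a) by field; rewrite gt_eqF.
rewrite -(ler_pM2l (_ : 0 < a / 8)); last by lra.
apply: le_trans key' _; rewrite le_eqVlt; apply/orP; left; apply/eqP.
by field; rewrite gt_eqF.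
Qed.

Hypotheses (c0 : 0 < c) (cd : c * d%:R <= 5^-1).

Lemma bavg_decay x :
  `|bavg u x| <= (2^-1 + 2 * energy) * expR (- (c * rho x y0)).
Proof.
rewrite bavgE; set t := c * rho x y0.
have U0 z : 0 <= W z * u z * (W z * u z) by rewrite -expr2 sqr_ge0.
apply: (@le_trans _ _ (\sum_z (2^-1 * expR (- t) * bker x z
    + 2 * expR (- t) * (h * (W z * u z * (W z * u z)))))).
  apply: le_trans (ler_norm_sum _ _ _) _; apply: ler_sum => z _.
  rewrite normrM ger0_norm ?bker_ge0 // bkerE.
  case: (boolP (sameb l x z)) => [s|_]; last first.
    rewrite mulr0 mul0r mulr0 add0r.
    apply: mulr_ge0; first by rewrite mulr_ge0 ?expR_ge0.
    by apply: mulr_ge0; [exact: ltW | exact: U0].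
  rewrite mulr1.
  have e : expR (- t) * expR t = 1 by rewrite -expRD addNr expR0.
  have p1 := expR_gt0 t; have p2 := expR_gt0 (- t).
  (* Two points of a block are within [d], and [c * d%:R <= 2^-1], so their weights differ by a
     factor of at most 2. *)
  have hw : expR t <= 2 * W z.
    have : expR t <= expR (2^-1 + c * rho z y0).
      rewrite ler_expR /t.
      have := ler_wpM2l (ltW c0) (rho_triangle R l x z y0).
      have := ler_wpM2l (ltW c0) (rho_same R l0 s).
      rewrite mulrDr; have := cd; lra.
    rewrite expRD => h1; apply: le_trans h1 _.
    by rewrite ler_wpM2r ?expR_ge0 // expR_le2.
  have := bilinear_exp_bound (- t) 1 (u z); rewrite mul1r opprK expr1n mul1r => b.
  have hw2 : expR t ^+ 2 <= 4 * W z ^+ 2.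
    have : expR t ^+ 2 <= (2 * W z) ^+ 2.
      by rewrite lerXn2r ?nnegrE ?mulr_ge0 ?expR_ge0.
    by rewrite exprMn => h1; apply: le_trans h1 _; rewrite ler_wpM2r ?sqr_ge0 //; lra.
  have b2 : u z ^+ 2 * expR t <= 4 * expR (- t) * (W z * u z * (W z * u z)).
    have -> : u z ^+ 2 * expR t = expR (- t) * u z ^+ 2 * expR t ^+ 2.
      have -> : expR (- t) * u z ^+ 2 * expR t ^+ 2 = (expR (- t) * expR t) * (u z ^+ 2 * expR t) by ring.
      by rewrite e mul1r.
    have := ler_wpM2l (mulr_ge0 (ltW p2) (sqr_ge0 (u z))) hw2; lra.
  have b3 : `|u z| <= 2^-1 * expR (- t) + 2 * expR (- t) * (W z * u z * (W z * u z)) by lra.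
  have := ler_wpM2l (ltW h0) b3; lra.
rewrite big_split /= -!mulr_sumr (sum_bker R NE l0) mulr1 /dot; lra.
Qed.

(** [v j] is the [j]-th inverse power applied to the delta function at [x], normalized for the
    volume [h] per site. *)
Variables (kappa1 : R) (x : Om) (v : nat -> Om -> R).
Hypothesis v0E : v 0 = (fun z => l%:R ^+ d * (z == x)%:R).
Hypothesis vE : forall j, neumann kappa1 (v j.+1) = v j.
Hypotheses (k1 : 1 <= kappa1) (c1 : c ^+ 2 * d%:R <= 4^-1) (c2 : c <= 2^-1).

Let hl : h * l%:R ^+ d = 1. Proof. by rewrite -exprMn mulVf ?expr1n // gt_eqF. Qed.

Lemma green_ge0 j z : 0 <= v j z.
Proof.
elim: j z => [|j IH] z; first by rewrite v0E mulr_ge0 ?exprn_ge0 ?ler0n.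
by apply: (minimum_principle (l := l) (lt_le_trans ltr01 k1)) => w; rewrite vE.
Qed.

Lemma green_sup z : v d z <= 4 ^+ d.
Proof.
have it j : iter j (neumann kappa1) (v j) = v 0.
  by elim: j => // j IH; rewrite iterSr vE.
by apply: (green_power_le NE l0 z k1 (x := x)); rewrite it v0E.
Qed.

(** Paired with the nonnegative [v j.+1], the supersolution inequality moves the operator back onto
    it and yields [v j]: each power at most doubles the moment, starting from the value [2 ^+ d] of
    [coshw] at its centre. *)
Lemma green_moment j : h * dot (v j) (fun z => expR (c * rho z x)) <= 2 ^+ j * 2 ^+ d.
Proof.
apply: (@le_trans _ _ (h * dot (v j) (coshw l c x))).
  rewrite ler_pM2l //; apply: ler_sum => z _; rewrite ler_wpM2l ?green_ge0 //.
  by apply: exp_rho_le_coshw; rewrite ltW.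
elim: j => [|j IH].
  by rewrite v0E dotZl dot_delta coshw_center mulrA hl expr0.
apply: (@le_trans _ _ (2 * (h * dot (v j) (coshw l c x)))); last first.
  by rewrite exprS -mulrA ler_pM2l.
rewrite mulrCA ler_pM2l // -(vE j) -massive_adj // -dotZr.
apply: ler_sum => z _; rewrite ler_wpM2l ?green_ge0 //.
have := massive_coshw l0 x z (ltW c0) c2 c1 k1; lra.
Qed.

(** By the triangle inequality the decay of [f] from [y0] is the decay at [x] times a growth
    [expR (c * rho z x)], which the moment bound absorbs. *)
Lemma green_source_bound j (f : Om -> R) (C : R) : 0 <= C ->
  (forall z, `|f z| <= C * expR (- (c * rho z y0))) ->
  `|h * dot (v j) f| <= C * (2 ^+ j * 2 ^+ d) * expR (- (c * rho x y0)).
Proof.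
move=> C0 hf; rewrite normrM (gtr0_norm h0).
apply: (@le_trans _ _ (h * (C * expR (- (c * rho x y0))
                         * dot (v j) (fun z => expR (c * rho z x))))).
  rewrite ler_pM2l //; apply: le_trans (ler_norm_sum _ _ _) _.
  rewrite mulr_sumr; apply: ler_sum => z _.
  rewrite normrM (ger0_norm (green_ge0 _ _)) mulrCA ler_wpM2l ?green_ge0 //.
  apply: le_trans (hf z) _; rewrite -mulrA ler_wpM2l // -expRD ler_expR.
  have := rho_triangle R l x z y0; rewrite (rho_sym R l x z) -(ler_pM2l c0) mulrDr; lra.
rewrite mulrCA.
apply: le_trans (ler_wpM2l _ (green_moment j)) _; last by rewrite mulrAC.
by rewrite mulr_ge0 ?expR_ge0.
Qed.

(** Only the weighted l^2 norm of [u] is known here, so Young's inequality with weight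
    [expR (t + c * rho z x)] splits the product: one half is a moment of [v d], the other uses its
    sup bound and the energy. Balancing the halves costs half of the rate. *)
Lemma green_tail_bound :
  `|h * dot (v d) u| <= 2^-1 * 4 ^+ d * (1 + energy) * expR (- (c / 2 * rho x y0)).
Proof.
set t := - (c / 2 * rho x y0).
have four : 2 ^+ d * 2 ^+ d = 4 ^+ d :> R by rewrite -exprMn; congr (_ ^+ d); ring.
rewrite normrM (gtr0_norm h0).
apply: (@le_trans _ _ (h * (2^-1 * expR t * dot (v d) (fun z => expR (c * rho z x))
   + 2^-1 * expR t * 4 ^+ d * dot (fun z => W z * u z) (fun z => W z * u z)))).
  rewrite ler_pM2l //; apply: le_trans (ler_norm_sum _ _ _) _.
  rewrite /dot !mulr_sumr -big_split; apply: ler_sum => z _ /=.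
  rewrite normrM (ger0_norm (green_ge0 _ _)).
  have g0 := green_ge0 d z; have gs := green_sup z.
  have := bilinear_exp_bound (t + c * rho z x) 1 (u z); rewrite mul1r expr1n mul1r.
  move=> b; have := ler_wpM2l g0 b.
  have b2 : u z ^+ 2 * expR (- (t + c * rho z x)) <= expR t * (W z * u z * (W z * u z)).
    have -> : expR t * (W z * u z * (W z * u z)) =
              u z ^+ 2 * expR (t + c * rho z y0 + c * rho z y0) by rewrite !expRD; ring.
    rewrite ler_wpM2l ?sqr_ge0 // ler_expR /t.
    have := rho_triangle R l x z y0; rewrite (rho_sym R l x z) -(ler_pM2l c0) mulrDr.
    have := mulr_ge0 (ltW c0) (rho_ge0 R l z y0); lra.
  have b3 : v d z * (u z ^+ 2 * expR (- (t + c * rho z x))) <=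
       4 ^+ d * (expR t * (W z * u z * (W z * u z))).
    by apply: ler_pM => //; rewrite mulr_ge0 ?sqr_ge0 ?expR_ge0.
  rewrite [expR (t + c * rho z x)]expRD; lra.
have gm := green_moment d; rewrite four in gm.
have := ler_wpM2l (expR_ge0 t) gm; lra.
Qed.

End KernelDecay.

Lemma coercive_kernel_decay (R : realType) (d N l M : nat) (a ak kappa c : R)
    (u : {ffun 'I_d -> 'I_N} -> R) (x y0 : {ffun 'I_d -> 'I_N}) :
  N = (M * l)%N -> (0 < l)%N -> (0 < N)%N -> (0 < d)%N ->
  0 < a -> a <= 1 -> a / 2 <= ak -> ak <= a -> 0 <= kappa ->
  c = a / (5 * d%:R) ->
  (forall z, massive l kappa (fun=> false) u z + ak * bavg l u z = (sameb l y0 z)%:R) ->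
  `|u x| <= (d%:R * ((3 + 2 * (64 / a ^+ 2)) * 4 ^+ d)
             + 2^-1 * 4 ^+ d * (1 + 64 / a ^+ 2)) * expR (- (c / 2 * rho R l x y0)).
Proof.
move=> NE l0 N0 d0 a0 a1 aka ak1 kappa0 cE hu.
have dR : 1 <= (d%:R : R) by rewrite ler1n.
have cdE : c * d%:R = a / 5 by rewrite cE; field; rewrite gt_eqF //; lra.
have c0 : 0 < c by rewrite cE divr_gt0 // mulr_gt0 //; lra.
have cd : c * d%:R <= 5^-1 by lra.
have cs : c <= 5^-1 by apply: le_trans cd; rewrite ler_peMr // ltW.
have ca : c * d%:R <= a / 5 by rewrite cdE.
have E := weighted_l2_bound NE l0 N0 a0 a1 aka ak1 kappa0 c0 ca hu.
set e := _ * dot _ _ in E.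
have k1 : 1 <= 1 + kappa by lra.
have c1 : c ^+ 2 * d%:R <= 4^-1.
  have : c * (c * d%:R) <= 5^-1 * 5^-1.
    by apply: ler_pM => //; [exact: ltW | rewrite mulr_ge0 // ltW].
  rewrite mulrA -expr2; lra.
have c2 : c <= 2^-1 by lra.
have /boolp.choice[G GE] : forall g, exists w : {ffun 'I_d -> 'I_N} -> R,
    massive l (1 + kappa) (fun=> false) w = g.
  by move=> g; apply: green_exists => //; lra.
pose v j := iter j G (fun z => l%:R ^+ d * (z == x)%:R).
have v0E : v 0 = (fun z => l%:R ^+ d * (z == x)%:R) by [].
have vE j : massive l (1 + kappa) (fun=> false) (v j.+1) = v j by rewrite /= GE.
pose f z := (sameb l y0 z)%:R - ak * bavg l u z.
have fu : massive l (1 + kappa) (fun=> false) u = (fun z => f z + u z).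
  by apply/funext => z; have := hu z; rewrite /f !massive_laplacian => <-; ring.
have e0 : 0 <= e by rewrite mulr_ge0 ?dot_ge0 // exprn_ge0 // invr_ge0.
(* The indicator contributes 2, since the exponential is at least [2^-1] on the block of [y0]; the
   average contributes [2^-1 + 2 * e], with [e] bounded by [E]. *)
have hf z : `|f z| <= (3 + 2 * (64 / a ^+ 2)) * expR (- (c * rho R l z y0)).
  have hb := bavg_decay NE l0 y0 u c0 cd z; rewrite -/e in hb.
  have hx : (sameb l y0 z)%:R <= 2 * expR (- (c * rho R l z y0)).
    case: (boolP (sameb l y0 z)) => [s|_]; last by rewrite mulr_ge0 ?expR_ge0.
    have : c * rho R l z y0 <= 2^-1.
      rewrite rho_sym; have := rho_same R l0 s; rewrite -(ler_pM2l c0) => ?; lra.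
    move=> /expR_le2 h2; by rewrite expRN ler_pdivlMr ?expR_gt0 // mul1r.
  apply: le_trans (ler_normB _ _) _; rewrite normrM (ger0_norm (ler0n _ _)).
  have ak0 : 0 <= ak by lra.
  rewrite (ger0_norm ak0).
  have h3 : ak * `|bavg l u z| <= `|bavg l u z| by rewrite ler_piMl //; lra.
  have p := expR_gt0 (- (c * rho R l z y0)).
  have h4 := ler_wpM2r (ltW p) E; lra.
set C := 3 + _ in hf *.
have C0 : 0 <= C.
  by rewrite /C addr_ge0 // mulr_ge0 // divr_ge0 // exprn_ge0 // ltW.
set h : R := l%:R^-1 ^+ d.
have h0l : h * l%:R ^+ d = 1 by rewrite -exprMn mulVf ?expr1n // pnatr_eq0 -lt0n.
have ux : h * dot (v 0) u = u x by rewrite v0E dotZl dot_delta mulrA h0l mul1r.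
set B := C * 4 ^+ d * expR (- (c * rho R l x y0)).
(* Write [v j] as the operator applied to [v j.+1], move it onto [u] by symmetry and use [fu]: the
   part with [f] costs at most [B] and the part with [u] is carried on. *)
have step j : (j <= d)%N -> `|u x| <= j%:R * B + `|h * dot (v j) u|.
  elim: j => [|j IH] jd; first by rewrite ux mul0r add0r.
  apply: le_trans (IH (ltnW jd)) _; rewrite -natr1 mulrDl mul1r -addrA lerD2l.
  rewrite -(vE j) -massive_adj fu dotDr mulrDr.
  apply: le_trans (ler_normD _ _) _; rewrite lerD2r.
  apply: le_trans (green_source_bound l0 c0 v0E vE k1 c1 c2 j.+1 C0 hf) _.
  rewrite /B ler_wpM2r ?expR_ge0 // ler_wpM2l //.
  apply: (@le_trans _ _ (2 ^+ d * 2 ^+ d)).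
    by rewrite ler_wpM2r ?exprn_ge0 // ler_weXn2l //; lra.
  by rewrite -exprMn -natrM.
apply: le_trans (step d (leqnn d)) _.
(* The source terms are weakened to the half rate of the tail term. *)
have hB : B <= C * 4 ^+ d * expR (- (c / 2 * rho R l x y0)).
  rewrite /B ler_wpM2l ?mulr_ge0 ?exprn_ge0 // ler_expR lerN2.
  by have := mulr_ge0 (ltW c0) (rho_ge0 R l x y0); lra.
have d0R : 0 <= (d%:R : R) by rewrite ler0n.
have hB' := ler_wpM2l d0R hB.
have ht := green_tail_bound NE l0 y0 u c0 v0E vE k1 c1 c2.
rewrite -/e -/h in ht.
have p : 0 <= 2^-1 * 4 ^+ d * expR (- (c / 2 * rho R l x y0)).
  by rewrite mulr_ge0 ?expR_ge0 // mulr_ge0 ?exprn_ge0 // invr_ge0.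
have hE := ler_wpM2l p E.
lra.
Qed.

Lemma sum_sqr_le_sqr_sum (R : realFieldType) (I : finType) (F : I -> R) :
  (forall i, 0 <= F i) -> \sum_i F i ^+ 2 <= (\sum_i F i) ^+ 2.
Proof.
move=> F0; rewrite [leRHS]expr2 mulr_suml; apply: ler_sum => i _.
rewrite expr2 ler_wpM2l // (bigD1 i) //= lerDl.
by apply: sumr_ge0.
Qed.

(** The unweighted coercivity: pairing with [f] and using Poincare gives [a / 2 * dot f f <= 0]. *)
Lemma averaged_massive_inj (R : realType) (d N l M : nat) (a ak kappa : R)
    (f : {ffun 'I_d -> 'I_N} -> R) :
  N = (M * l)%N -> (0 < l)%N -> (0 < N)%N ->
  0 < a -> a <= 1 -> a / 2 <= ak -> 0 <= kappa ->
  (forall x, massive l kappa (fun=> false) f x + ak * bavg l f x = 0) ->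
  f =1 fun=> 0.
Proof.
move=> NE l0 N0 a0 a1 aka kappa0 hf; apply: dot_eq0.
have : dot f (fun x => massive l kappa (fun=> false) f x + ak * bavg l f x) = 0.
  by apply: big1 => x _; rewrite hf mulr0.
rewrite dotDr massive_form dotZr.
have hp := poincare NE l0 N0 f (enum_uniq 'I_d).
rewrite big_enum /= -/(bavg l f) in hp.
have b0 : 0 <= dot f (bavg l f) by apply: (avgs_ge0 NE l0); exact: enum_uniq.
set G := \sum_mu dot (grad l mu f) (grad l mu f) in hp *.
have G0 : 0 <= G by apply: sumr_ge0 => mu _; exact: dot_ge0.
have h1 := mulr_ge0 kappa0 (dot_ge0 f).
have h2 := ler_wpM2r b0 aka.
have h3 : a / 2 * G <= G by rewrite ler_piMl //; lra.
have a20 : 0 < a / 2 by lra.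
have h4 := ler_wpM2l (ltW a20) hp.
move=> h5; rewrite -(ler_pM2l a20) mulr0; lra.
Qed.

(** * Blocks and the operators of the model *)

Section BlockGeometry.
Variables (R : realType) (d L k m : nat).
Hypotheses (L1 : (1 < L)%N) (km : (k <= m)%N).
Local Notation Om := {ffun 'I_d -> 'I_(L ^ m)}.
Local Notation Ok := {ffun 'I_d -> 'I_(L ^ (m - k))}.
Local Notation l := (L ^ k)%N.

Lemma volume_split : (L ^ m = L ^ (m - k) * l)%N.
Proof. by rewrite -expnD subnK. Qed.

Lemma block_gt0 : (0 < l)%N.
Proof. by rewrite expn_gt0 (ltnW L1). Qed.

Lemma block_index_subproof (i : 'I_(L ^ m)) : (i %/ l < L ^ (m - k))%N.
Proof. by rewrite ltn_divLR ?block_gt0 // -volume_split. Qed.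

Definition block_of (x : Om) : Ok :=
  [ffun mu => Ordinal (block_index_subproof (x mu))].

Lemma corner_subproof (j : 'I_(L ^ (m - k))) : (j * l < L ^ m)%N.
Proof. by rewrite volume_split ltn_pmul2r ?block_gt0. Qed.

(** The physical position of this lattice point is exactly [y], so it serves as the centre [y0] of
    the weights. *)
Definition corner (y : Ok) : Om := [ffun mu => Ordinal (corner_subproof (y mu))].

Lemma etaE : Defs.eta R L k = (l%:R)^-1.
Proof. by rewrite /Defs.eta natrX. Qed.

Lemma inBlockE (y : Ok) (x : Om) : inBlock R y x = (y == block_of x).
Proof.
have lR : 0 < (l%:R : R) by rewrite ltr0n block_gt0.
have E mu : ((y mu)%:R <= Defs.eta R L k * (x mu)%:R) && (Defs.eta R L k * (x mu)%:R < (y mu)%:R + 1)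
   = (x mu %/ l == y mu)%N.
  rewrite etaE ler_pdivlMl // ltr_pdivrMl // natr1 -!natrM ler_nat ltr_nat.
  by rewrite [RHS]eqn_leq -[(_ %/ _ <= _)%N]ltnS ltn_divLR ?block_gt0 // leq_divRL ?block_gt0 // andbC ![(l * _)%N]mulnC.
apply/forallP/eqP => [h|e mu]; last by rewrite E e ffunE.
by apply/ffunP => mu; apply: ord_inj; rewrite ffunE /=; have := h mu; rewrite E => /eqP.
Qed.

Lemma QadjE (g : Ok -> R) (x : Om) : Qadj g x = g (block_of x).
Proof.
by rewrite /Qadj (eq_bigl (pred1 (block_of x))) ?big_pred1_eq // => y; rewrite inBlockE.
Qed.

Lemma block_of_sameb (x z : Om) : (block_of x == block_of z) = sameb l x z.
Proof.
apply/eqP/forallP => [e mu|e].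
  by have := congr1 (fun y : Ok => val (y mu)) e; rewrite !ffunE /= /same => ->.
by apply/ffunP => mu; apply: ord_inj; rewrite !ffunE /=; apply/eqP; exact: e.
Qed.

Lemma Qadj_Qop (f : Om -> R) (x : Om) : @Qadj R d L k m (@Qop R d L k m f) x = bavg l f x.
Proof.
rewrite QadjE /Qop bavgE mulr_sumr big_mkcond; apply: eq_bigr => z _.
rewrite inBlockE block_of_sameb bkerE natrX exprVn -exprM.
by case: ifP; rewrite ?mulr1 // mulr0 mul0r.
Qed.

Lemma block_of_corner (y : Ok) : block_of (corner y) = y.
Proof. by apply/ffunP => mu; apply: ord_inj; rewrite !ffunE /= mulnK ?block_gt0. Qed.

Lemma Qadj_delta (y : Ok) (x : Om) :
  Qadj (fun y' => (y' == y)%:R : R) x = (sameb l (corner y) x)%:R.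
Proof. by rewrite QadjE -block_of_sameb block_of_corner eq_sym. Qed.

Lemma dist_le_rho (x : Om) (y : Ok) : dist R x y <= rho R l x (corner y).
Proof.
rewrite /dist -[rho _ _ _ _]ger0_norm ?rho_ge0 // -sqrtr_sqr ler_wsqrtr //.
have lR : 0 < (l%:R : R) by rewrite ltr0n block_gt0.
have E mu : (Defs.eta R L k * (x mu)%:R - (y mu)%:R) ^+ 2 =
    (l%:R^-1 * `|(x mu)%:R - (corner y mu)%:R|) ^+ 2.
  rewrite exprMn real_normK ?num_real // -exprMn ffunE /= natrM etaE; congr (_ ^+ 2).
  by field; rewrite gt_eqF.
under eq_bigr => mu _ do rewrite E.
apply: sum_sqr_le_sqr_sum => mu; rewrite mulr_ge0 // ?invr_ge0 ltW //.
Qed.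

(** After rescaling, the neighbours [nbr] and the updates by [up] and [dn] agree by conversion. *)
Lemma opAE (a mu0 : R) : @opA R d L k m a mu0 =
  (fun f x => massive l (mu_k L k mu0) (fun=> false) f x + a_k L k a * bavg l f x).
Proof.
apply/funext => f; apply/funext => x; rewrite /opA Qadj_Qop massive_laplacian.
rewrite /lapN etaE exprVn invrK; congr (_ + _); rewrite addrC; congr (_ - _ * _).
Qed.

(** With p = L^(-2k) and q = L^(-2) one has 0 < p <= q <= 1/4, so the ratio (1 - q) / (1 - p) lies
    between 3/4 and 1. *)
Lemma a_k_bounds (a : R) : (0 < k)%N -> 0 < a -> a / 2 <= a_k L k a <= a.
Proof.
move=> k0 a0; rewrite /a_k.
have LR : 2 <= (L%:R : R) by rewrite ler_nat.
have L2 : 4 <= (L%:R : R) ^+ 2.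
  have : (2 : R) ^+ 2 <= L%:R ^+ 2 by rewrite lerXn2r ?nnegrE //; lra.
  lra.
have q1 : ((L%:R : R) ^+ 2)^-1 <= 4^-1 by rewrite lef_pV2 ?posrE //; lra.
have pq : ((L%:R : R) ^+ (2 * k))^-1 <= (L%:R ^+ 2)^-1.
  have Lp j : 0 < (L%:R : R) ^+ j by rewrite exprn_gt0 //; lra.
  by rewrite lef_pV2 ?posrE ?Lp // ler_weXn2l ?leq_pmulr //; lra.
have p0 : 0 < ((L%:R : R) ^+ (2 * k))^-1 by rewrite invr_gt0 exprn_gt0 //; lra.
set q := (_ ^+ 2)^-1 in q1 pq *; set p := (_ ^+ (2 * k))^-1 in pq p0 *.
have P : 0 < 1 - p by lra.
rewrite ler_pdivlMr // ler_pdivrMr // ler_pM2l // lerD2l lerN2 pq andbT.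
rewrite -mulrA ler_pM2l //; lra.
Qed.

End BlockGeometry.

(** * Uniform exponential decay of the block-spin kernel *)

Theorem mainTheorem18 (R : realType) (d : nat) (a : R) :
  (0 < d)%N -> 0 < a <= 1 ->
  exists c c1 : R, 0 < c /\ 0 < c1 /\
    forall (L k m : nat) (mu0 : R),
      odd L -> (1 < L)%N -> (1 <= k)%N -> (k <= m)%N -> 0 <= mu0 ->
      forall (x : {ffun 'I_d -> 'I_(L ^ m)}) (y : {ffun 'I_d -> 'I_(L ^ (m - k))}),
        `|@GQ_kernel R d L k m a mu0 x y| <= c * expR (- c1 * @dist R d L k m x y).
Proof.
move=> d0 /andP[a0 a1].
have dR : 0 < (d%:R : R) by rewrite ltr0n.
(* This makes [c * d%:R] equal to [a / 5], the largest rate that the coercivity estimate allows. *)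
pose c : R := a / (5 * d%:R).
have c0 : 0 < c by rewrite divr_gt0 // mulr_gt0.
have A0 : 0 < 64 / a ^+ 2 by rewrite divr_gt0 // exprn_gt0.
have p4 : 0 < (4 : R) ^+ d by rewrite exprn_gt0.
have c20 : 0 < c / 2 by rewrite divr_gt0.
pose K := d%:R * ((3 + 2 * (64 / a ^+ 2)) * 4 ^+ d)
          + 2^-1 * 4 ^+ d * (1 + 64 / a ^+ 2).
have K0 : 0 < K.
  apply: addr_gt0; first by rewrite mulr_gt0 // mulr_gt0 //; lra.
  by apply: mulr_gt0; [rewrite mulr_gt0 ?invr_gt0 | lra].
exists K, (c / 2); split=> //; split=> //.
move=> L k m mu0 _ L1 k1 km mu00 x y.
have l0 := block_gt0 k L1.
have NE := volume_split L km.
have N0 : (0 < L ^ m)%N by rewrite expn_gt0 (ltnW L1).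
have /andP[ak1 ak2] := a_k_bounds L1 k1 a0.
have kappa0 : 0 <= mu_k L k mu0 by rewrite mulr_ge0 // exprn_ge0.
pose T := @opA R d L k m a mu0.
have TE : T = _ := opAE d L1 km a mu0.
have TD f g : T (fun z => f z + g z) = (fun z => T f z + T g z).
  rewrite TE massiveD /bavg alongsD; apply/funext => z; ring.
have TZ e f : T (fun z => e * f z) = (fun z => e * T f z).
  rewrite TE massiveZ /bavg alongsZ; apply/funext => z; ring.
have Tinj f : T f =1 (fun=> 0) -> f =1 (fun=> 0).
  by rewrite TE; exact: averaged_massive_inj NE l0 N0 a0 a1 ak1 kappa0.
pose g z : R := Qadj (fun y' : {ffun 'I_d -> 'I_(L ^ (m - k))} => (y' == y)%:R) z.
pose u z := @GQ_kernel R d L k m a mu0 z y.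
(* [matA] is convertible to [mx_of T], so the kernel column is the solution produced by
   [invmx_solves]. *)
have hu : T u = g by exact: invmx_solves TD TZ Tinj g.
have huE z : massive (L ^ k) (mu_k L k mu0) (fun=> false) u z
    + a_k L k a * bavg (L ^ k) u z = (sameb (L ^ k) (corner L1 km y) z)%:R.
  transitivity (T u z); first by rewrite TE.
  by rewrite hu /g Qadj_delta.
have := coercive_kernel_decay x NE l0 N0 d0 a0 a1 ak1 ak2 kappa0 (erefl c) huE.
move=> key; apply: le_trans key _; rewrite ler_pM2l //.
rewrite ler_expR mulNr lerN2 ler_pM2l //; exact: dist_le_rho.
Qed.
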